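(* Let $\mathcal{D}$ be a finitely supported value distribution on $[0,1]$, let $n\ge 1$, and let $\delta\in(0,1)$ be a constant. There exists a repeated auction (not depending on the particular algorithms used by the buyers) such that, whenever $n$ buyers with values drawn i.i.d. from $\mathcal{D}$ bid using strategies that are mean-based, the expected total revenue of the seller over the $T$ rounds is at least $T\cdot(1-\delta)\,\mathsf{Val}_n(\mathcal{D})-o(T)$, where $\mathsf{Val}_n(\mathcal{D})=\mathbb{E}_{\vec v\leftarrow\mathcal{D}^n}[\max_i v_i]$.
   Context: Setting. There are $n$ buyers and $T$ rounds, with one item for sale in each round. Buyer $i$'s value in round $t$ is $v_{i,t}$; all $v_{i,t}$ are independent draws from $\mathcal{D}$, which has finite support $0\le w_1<\dots<w_m\le 1$ with $\Pr[w_j]=q_j$. Asymptotic notation is for $T\to\infty$ with $n,\mathcal{D},\delta$ fixed; a ''repeated auction'' and a ''strategy'' are families indexed by $T$. Repeated auction. The seller fixes a finite set of arms, the same for all buyers and all rounds, each labelled by a nonnegative bid (labels may exceed all possible values), with one arm labelled $0$ (non-participation). For each round $t$ the seller specifies, for every vector $\vec b=(b_1,\dots,b_n)$ of arms pulled, the probability $a_{i,t}(\vec b)\in[0,1]$ that buyer $i$ gets the item and the price $p_{i,t}(\vec b)\in[0,b_i\cdot a_{i,t}(\vec b)]$ that buyer $i$ pays, subject to: $\sum_i a_{i,t}(\vec b)\le 1$; anonymity (invariance under permuting the buyers); and monotonicity: $b_i'>b_i$ implies $a_{i,t}(b_i;\vec b_{-i})\le a_{i,t}(b_i';\vec b_{-i})$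 and $p_{i,t}(b_i;\vec b_{-i})\le p_{i,t}(b_i';\vec b_{-i})$. Revenue is $\sum_{t}\sum_i p_{i,t}(\vec b_t)$, where $\vec b_t$ is the vector of arms pulled in round $t$; the expectation is over the values and the buyers' randomness. Buyers. A strategy of buyer $i$ chooses (possibly at random) an arm in round $t$ based on $v_{i,t}$ and what was observed in earlier rounds (either only the payoff function of the pulled arm, or the payoff functions of all arms). Write $r_{ibt}(v)=v\cdot a_{i,t}(b;\vec b_{-i,t})-p_{i,t}(b;\vec b_{-i,t})$ for the utility buyer $i$ with value $v$ would get in round $t$ from arm $b$ given the other buyers' pulls $\vec b_{-i,t}$, and $\sigma_{i,b,s}(v)=\sum_{t<s}r_{ibt}(v)$. The strategy is $\gamma$-mean-based if, whenever $\sigma_{i,b,s}(v_{i,s})<\sigma_{i,b',s}(v_{i,s})-\gamma T$ for some arms $b,b'$, the probability that arm $b$ is pulled in round $s$ is at most $\gamma$. It is mean-based if it is $\gamma$-mean-based for some $\gamma=\gamma(T)=o(1)$. *)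

(* Defs.v *)
From HB Require Import structures.
From mathcomp Require Import all_boot all_order all_algebra all_fingroup.
From mathcomp Require Import all_classical all_reals all_analysis.

Set Implicit Arguments.
Unset Strict Implicit.
Unset Printing Implicit Defensive.

Import Order.TTheory GRing.Theory Num.Theory.
Import numFieldNormedType.Exports.
Local Open Scope ring_scope.

Record value_dist (R : realType) := ValueDist {
  supp_size : nat;
  value : 'I_supp_size -> R;
  prob : 'I_supp_size -> R;
  value_incr : forall j k : 'I_supp_size, (j < k)%N -> value j < value k;
  value_bounds : forall j, 0 <= value j <= 1;
  prob_gt0 : forall j, 0 < prob j;
  prob_sum1 : \sum_j prob j = 1
}.

(* The seed 0 of the maximum is harmless: values are nonnegative. *)
Definition Val (R : realType) (n : nat) (D : value_dist R) : R :=
  \sum_(f : {ffun 'I_n -> 'I_(supp_size D)})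
    (\prod_i prob (f i)) * \big[Num.max/0]_i value (f i).

Record arm_set (R : realType) := ArmSet {
  arm :> finType;
  label : arm -> R;
  label_inj : injective label;
  label_ge0 : forall b, 0 <= label b;
  null_arm : arm;
  label_null : label null_arm = 0
}.

Section Bids.
Context {R : realType} {K : arm_set R} {n : nat}.

Definition bids := {ffun 'I_n -> K}.

Definition deviate (bs : bids) (i : 'I_n) (b : K) : bids :=
  [ffun j => if j == i then b else bs j].

(* In [permute bs s], buyer [i] bids what buyer [s i] bids in [bs]. *)
Definition permute (bs : bids) (s : {perm 'I_n}) : bids := [ffun j => bs (s j)].

End Bids.
Arguments bids {R} K n.

(* The rules of all T rounds are fixed in advance: they do not react to play.
   A price is charged whether or not the buyer gets the item, hence the bound
   [price <= label * alloc] rather than [price <= label]. *)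
Record auction (R : realType) (K : arm_set R) (n T : nat) := Auction {
  alloc : 'I_T -> bids K n -> 'I_n -> R;
  price : 'I_T -> bids K n -> 'I_n -> R;
  alloc_bounds : forall t (bs : bids K n) i, 0 <= alloc t bs i <= 1;
  alloc_feasible : forall t (bs : bids K n), \sum_i alloc t bs i <= 1;
  price_bounds : forall t (bs : bids K n) i,
    0 <= price t bs i <= label (bs i) * alloc t bs i;
  alloc_null : forall t (bs : bids K n) i,
    bs i = null_arm K -> alloc t bs i = 0;
  alloc_anonymous :
    forall t (bs : bids K n) (s : {perm 'I_n}) i,
      alloc t (permute bs s) i = alloc t bs (s i);
  price_anonymous :
    forall t (bs : bids K n) (s : {perm 'I_n}) i,
      price t (permute bs s) i = price t bs (s i);
  alloc_monotone : forall t (bs : bids K n) i (b b' : K), label b < label b' ->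
    alloc t (deviate bs i b) i <= alloc t (deviate bs i b') i;
  price_monotone : forall t (bs : bids K n) i (b b' : K), label b < label b' ->
    price t (deviate bs i b) i <= price t (deviate bs i b') i
}.

Section Utility.
Context {R : realType} {K : arm_set R} {n T : nat}.

(* r_{i,b,t}(v) when the other buyers pull as in [bs]; [bs i] is ignored. *)
Definition payoff (A : auction K n T) (t : 'I_T) (bs : bids K n) (i : 'I_n)
    (b : K) : R -> R :=
  fun v => v * alloc A t (deviate bs i b) i - price A t (deviate bs i b) i.

End Utility.

Inductive feedback := PulledArmOnly | AllArms.

Section Play.
Context {R : realType} {D : value_dist R} {K : arm_set R}.

(* What a buyer remembers of a past round: her value (as an index into the
   support of D), the arm she pulled, and the payoff functions revealed to her
   ([None] for an arm whose payoff function is not revealed). *)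
Record memory := Memory {
  own_value : 'I_(supp_size D);
  own_arm : K;
  revealed : K -> option (R -> R)
}.

(* [pull_prob h v b] is the probability of pulling [b] with current value [v]
   after the past rounds [h], listed in chronological order; the index of the
   current round is [size h]. Private randomness that persists across rounds
   is covered, since [h] contains the buyer's own pulls. *)
Record strategy := Strategy {
  pull_prob : seq memory -> 'I_(supp_size D) -> K -> R;
  pull_prob_ge0 : forall h v b, 0 <= pull_prob h v b;
  pull_prob_sum1 : forall h v, \sum_b pull_prob h v b = 1
}.

Context {n T : nat}.

Definition outcome := {ffun 'I_T -> {ffun 'I_n -> 'I_(supp_size D) * K}}.

Definition value_at (w : outcome) (t : 'I_T) (i : 'I_n) : 'I_(supp_size D) :=
  (w t i).1.

Definition pulls_at (w : outcome) (t : 'I_T) : bids K n :=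
  [ffun i => (w t i).2].

Context (A : auction K n T) (fb : 'I_n -> feedback) (S : 'I_n -> strategy).

Definition remember (w : outcome) (i : 'I_n) (t : 'I_T) : memory :=
  let bs := pulls_at w t in
  Memory (value_at w t i) (bs i)
    (fun b => match fb i with
              | AllArms => Some (payoff A t bs i b)
              | PulledArmOnly =>
                  if b == bs i then Some (payoff A t bs i b) else None
              end).

Definition history (w : outcome) (i : 'I_n) (s : 'I_T) : seq memory :=
  [seq remember w i t | t : 'I_T <- enum 'I_T & (t < s)%N].

(* Probability of the outcome [w]: in each round the values are drawn afresh
   from D, and then the buyers pull arms, independently of each other given
   the past. *)
Definition outcome_prob (w : outcome) : R :=
  \prod_(t < T) \prod_(i < n)
    (prob (value_at w t i)
     * pull_prob (S i) (history w i t) (value_at w t i) (pulls_at w t i)).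

Definition Pr (E : pred outcome) : R := \sum_(w | E w) outcome_prob w.

Definition expected_revenue : R :=
  \sum_(w : outcome)
    outcome_prob w * \sum_(t < T) \sum_(i < n) price A t (pulls_at w t) i.

Definition sigma (w : outcome) (i : 'I_n) (b : K) (s : 'I_T) (v : R) : R :=
  \sum_(t < T | (t < s)%N) payoff A t (pulls_at w t) i b v.

Definition lags (gamma : R) (i : 'I_n) (s : 'I_T) (b b' : K) : pred outcome :=
  fun w => let v := value (value_at w s i) in
    sigma w i b s v < sigma w i b' s v - gamma * T%:R.

(* Conditional probability at most gamma, in product form in case
   [Pr (lags ...) = 0]. The sums [sigma] are random and not functions of what
   the buyer observes, so the probability of pulling [b] is conditioned on the
   event that [b] lags behind [b']. This is implied by the more demanding
   requirement that [pull_prob] give [b] probability at most gamma after every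
   history at which [b] lags. *)
Definition gamma_mean_based (gamma : R) (i : 'I_n) : Prop :=
  forall (s : 'I_T) (b b' : K),
    Pr (fun w => lags gamma i s b b' w && (pulls_at w s i == b))
      <= gamma * Pr (lags gamma i s b b').

End Play.
Arguments strategy {R} D K.

Local Open Scope classical_set_scope.

Definition mean_based (R : realType) (D : value_dist R) (K : arm_set R)
    (n : nat) (A : forall T, auction K n T) (fb : 'I_n -> feedback)
    (S : nat -> 'I_n -> strategy D K) (i : 'I_n) : Prop :=
  exists2 gamma : nat -> R, gamma @ \oo --> (0 : R) &
    forall T, gamma_mean_based (A T) fb (S T) (gamma T) i.

(* Main.v *)
(** Time is cut into [N] sessions. In its session an arm of type [j] plays a
    per-round mechanism that is efficient up to [eps] and in which, whatever the
    others do, reporting one's type beats any other report by a fixed margin;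
    afterwards the arm has top priority and a price [P] far above all values, so
    that its payoffs are at most [- H]. All margins hold for every behaviour of
    the other buyers, so no concentration argument is needed.

    Welfare: an arm of a former session carries a score of at most one session
    length, lost within a fraction [1/H] of the next session. After that (and
    o(T) rounds) the arm of the buyer's own type leads all others by more than
    [gamma T], and the item goes to a highest value up to a factor [1 - eps].

    Utility: outside o(T) rounds, in which the scores of two different arms cross,
    all arms within [gamma T] of the best score have the same current payoff, and
    following the leader earns at most the increase of the maximal score. As the
    current value is independent of the past and of the other buyers' pulls, the
    expected utility of a buyer telescopes to the final maximal score, which is at
    most one session length, T/N. The revenue is the welfare minus the utilities. *)

Require Import Defs.
From HB Require Import structures.
From mathcomp Require Import all_boot all_order all_algebra all_fingroup.
From mathcomp Require Import all_classical all_reals all_analysis.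
From mathcomp Require Import ring lra zify.
Import Order.TTheory GRing.Theory Num.Theory.
Import numFieldNormedType.Exports.
Local Open Scope ring_scope.

Set Implicit Arguments.
Unset Strict Implicit.
Unset Printing Implicit Defensive.

(** * The mechanism of one round *)

Section Mechanism.
Context {R : realType} {n : nat}.
Implicit Types (s : 'I_n -> nat) (i : 'I_n) (c l : nat).

(** A status is the report seen by the mechanism of one round; arms are translated into statuses
    session by session. *)
Definition with_status s i c : 'I_n -> nat := fun j => if j == i then c else s j.

Lemma with_status_self s i c : with_status s i c i = c.
Proof. by rewrite /with_status eqxx. Qed.

Lemma with_status_id s i : with_status s i (s i) = s.
Proof. by apply/funext => j; rewrite /with_status; case: eqVneq => // ->. Qed.

Lemma with_statusK s i c l :
  with_status (with_status s i c) i l = with_status s i l.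
Proof. by apply/funext => j; rewrite /with_status; case: eqVneq. Qed.

Lemma with_status_perm s (p : {perm 'I_n}) i c :
  with_status (s \o p) i c = with_status s (p i) c \o p.
Proof. by apply/funext => j; rewrite /with_status /= (inj_eq perm_inj). Qed.

(** The condition [0 < s i] keeps the item from buyers of status 0 even when all have it, since a
    null arm must receive nothing. *)
Definition top_share s i : R :=
  if (0 < s i)%N && [forall j, (s j <= s i)%N]
  then (#|[pred j | s j == s i]|%:R)^-1 else 0.

Lemma top_share_bounds s i : 0 <= top_share s i <= 1.
Proof.
rewrite /top_share; case: ifP => _; last by rewrite lexx ler01.
rewrite invr_ge0 ler0n /= invf_le1 ?ltr0n ?ler1n.
all: by apply/card_gt0P; exists i; rewrite inE.
Qed.

Lemma top_share_sum s : \sum_i top_share s i <= 1.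
Proof.
rewrite /top_share -big_mkcond /=.
set W := fun i => (0 < s i)%N && [forall j, (s j <= s i)%N].
have eqW i : W i -> [pred j | s j == s i] =i W.
  move=> /andP[si0 /forallP si] j; rewrite inE [RHS]/(W j).
  apply/eqP/andP => [->|[_ /forallP sj]]; first by split=> //; apply/forallP.
  by apply/eqP; rewrite eqn_leq si sj.
rewrite (eq_bigr (fun=> (#|W|%:R)^-1)); last by move=> i /eqW /eq_card ->.
rewrite sumr_const -[X in X <= _]mulr_natl.
have [->|W0] := eqVneq #|W| 0%N; first by rewrite mul0r ler01.
by rewrite divff // pnatr_eq0.
Qed.

(** A buyer who is among the top at [c] is alone at the top at any larger [c']; otherwise the share
    at [c] is 0. *)
Lemma top_share_mono s i c c' : (c <= c')%N ->
  top_share (with_status s i c) i <= top_share (with_status s i c') i.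
Proof.
rewrite leq_eqVlt => /predU1P[->//|cc'].
rewrite {1}/top_share; case: ifP => [|_]; last first.
  by case/andP: (top_share_bounds (with_status s i c') i).
rewrite with_status_self => /andP[_ /forallP le_c].
have lt_c' j : j != i -> (with_status s i c' j < c')%N.
  move=> ji; apply: leq_ltn_trans cc'.
  by have := le_c j; rewrite /with_status (negPf ji).
suff -> : top_share (with_status s i c') i = 1.
  rewrite invf_le1 ?ltr0n ?ler1n; apply/card_gt0P; exists i;
  by rewrite inE with_status_self.
rewrite /top_share with_status_self (leq_ltn_trans _ cc')//=.
rewrite ifT; last first.
  apply/forallP => j; have [->|/lt_c'/ltnW//] := eqVneq j i.
  by rewrite with_status_self.
rewrite (eq_card (B := pred1 i)) ?card1 ?invr1// => j; rewrite !inE.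
have [->|ji] := eqVneq j i; first by rewrite with_status_self eqxx.
by rewrite ltn_eqF// lt_c'.
Qed.

(** * Efficient allocation mixed with a small lottery *)

Context (m : nat) (eps : R).

Definition alloc_at s i : R :=
  eps / n%:R * ((s i)%:R / m.+1%:R) + (1 - eps) * top_share s i.

(* The lottery of weight [eps] makes the allocation increase by at least this
   much with each status, whatever the others do; this is what makes the
   incentives strict. *)
Definition alloc_step : R := eps / n%:R / m.+1%:R.

Context (heps : 0 < eps < 1).

Lemma alloc_step_gt0 i : 0 < alloc_step.
Proof.
rewrite /alloc_step !divr_gt0 ?ltr0n//; first by case/andP: heps.
exact: leq_ltn_trans (ltn_ord i).
Qed.

Lemma alloc_at0 s i : s i = 0%N -> alloc_at s i = 0.
Proof. by move=> si; rewrite /alloc_at /top_share si mul0r !mulr0 addr0. Qed.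

Lemma alloc_at_bounds s i : (s i <= m.+1)%N -> 0 <= alloc_at s i <= 1.
Proof.
move=> si; have /andP[e0 e1] := heps.
have /andP[t0 t1] := top_share_bounds s i.
have n0 : (0 < n)%N by exact: leq_ltn_trans (ltn_ord i).
have sm : (s i)%:R / m.+1%:R <= 1 :> R by rewrite ler_pdivrMr ?ltr0n// mul1r ler_nat.
have en : eps / n%:R <= eps by rewrite ler_pdivrMr ?ltr0n// ler_peMr ?ler1n// ltW.
have sm0 : 0 <= (s i)%:R / m.+1%:R :> R by rewrite divr_ge0.
have en0 : 0 <= eps / n%:R by rewrite divr_ge0// ltW.
rewrite /alloc_at; move: (_ / _) (top_share _ _) (eps / _) sm sm0 t0 t1 en en0.
by move=> a b d *; apply/andP; split; nra.
Qed.

Lemma alloc_at_feasible s : (0 < n)%N -> (forall i, (s i <= m.+1)%N) ->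
  \sum_i alloc_at s i <= 1.
Proof.
move=> n0 sm; have /andP[e0 e1] := heps.
rewrite big_split/= -!mulr_sumr.
have le1 : \sum_i (s i)%:R / m.+1%:R <= n%:R :> R.
  rewrite -[X in _ <= X%:R]card_ord -sum1_card natr_sum; apply: ler_sum => i _.
  by rewrite ler_pdivrMr ?ltr0n// mul1r ler_nat.
have : eps / n%:R * (\sum_i (s i)%:R / m.+1%:R) <= eps.
  rewrite -mulrA ger_pMr// mulrC ler_pdivrMr ?ltr0n ?mul1r//.
have : (1 - eps) * \sum_i top_share s i <= 1 - eps.
  by rewrite ger_pMr ?subr_gt0// top_share_sum.
by lra.
Qed.

Definition alloc_incr s i l : R :=
  alloc_at (with_status s i l.+1) i - alloc_at (with_status s i l) i.

Lemma alloc_incr_ge s i l : alloc_step <= alloc_incr s i l.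
Proof.
have /andP[e0 e1] := heps.
rewrite /alloc_incr /alloc_at /alloc_step !with_status_self.
have := top_share_mono s i (leqnSn l).
rewrite -subr_ge0 -(pmulr_rge0 _ (_ : 0 < 1 - eps)) ?subr_gt0//.
rewrite -[l.+1%:R]natr1.
move: (top_share _ _) (top_share _ _) (l%:R) (m.+1%:R^-1) (eps / _).
by move=> a b x y z; lra.
Qed.

Lemma alloc_incr_ge0 s i l : 0 <= alloc_incr s i l.
Proof. exact: le_trans (ltW (alloc_step_gt0 i)) (alloc_incr_ge s i l). Qed.

(** Telescoping from status 0, which receives nothing. Prices are weighted sums of the same
    increments, so payoffs compare term by term. *)
Lemma alloc_at_sum s i c :
  alloc_at (with_status s i c) i = \sum_(0 <= l < c) alloc_incr s i l.
Proof.
by rewrite /alloc_incr telescope_sumr// [X in _ - X]alloc_at0 ?subr0 ?with_status_self.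
Qed.

Lemma alloc_at_mono s i c c' : (c <= c')%N ->
  alloc_at (with_status s i c) i <= alloc_at (with_status s i c') i.
Proof.
apply: (@homo_leq _ (fun c => alloc_at (with_status s i c) i) <=%R) => //.
  exact: le_trans.
by move=> l; rewrite -subr_ge0 alloc_incr_ge0.
Qed.

Lemma top_share_perm s (p : {perm 'I_n}) i :
  top_share (s \o p) i = top_share s (p i).
Proof.
rewrite /top_share/=.
have -> : [forall j, (s (p j) <= s (p i))%N] = [forall j, (s j <= s (p i))%N].
  apply/forallP/forallP => h j; last exact: h.
  by have := h (p^-1%g j); rewrite /= permKV.
suff -> : #|[pred j | s (p j) == s (p i)]| = #|[pred j | s j == s (p i)]| by [].
by rewrite -!sum1_card [RHS](reindex_inj (@perm_inj _ p)).
Qed.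

Lemma alloc_at_perm s (p : {perm 'I_n}) i :
  alloc_at (s \o p) i = alloc_at s (p i).
Proof. by rewrite /alloc_at top_share_perm. Qed.

(** * Threshold payments and the payoff of each status *)

Context (tau : nat -> R).

(* Myerson payments for the thresholds [tau]: reaching status [l+1] is worth
   its price exactly for values above [tau l]. *)
Definition price_at s i : R := \sum_(0 <= l < s i) tau l * alloc_incr s i l.

Lemma price_at_with s i c :
  price_at (with_status s i c) i = \sum_(0 <= l < c) tau l * alloc_incr s i l.
Proof.
rewrite /price_at with_status_self; apply: eq_bigr => l _.
by rewrite /alloc_incr !with_statusK.
Qed.

Lemma price_at_perm s (p : {perm 'I_n}) i :
  price_at (s \o p) i = price_at s (p i).
Proof.
apply: eq_bigr => l _.
by rewrite /alloc_incr !with_status_perm !alloc_at_perm.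
Qed.

Context (P : R) (htau : forall l, 0 <= tau l <= P).

Lemma price_at_bounds s i : 0 <= price_at s i <= P * alloc_at s i.
Proof.
have := alloc_at_sum s i (s i); rewrite with_status_id => ->.
rewrite /price_at mulr_sumr; apply/andP; split.
  apply: sumr_ge0 => l _.
  by rewrite mulr_ge0 ?alloc_incr_ge0//; case/andP: (htau l).
apply: ler_sum => l _.
by rewrite ler_wpM2r ?alloc_incr_ge0//; case/andP: (htau l).
Qed.

Lemma price_at_mono s i c c' : (c <= c')%N ->
  price_at (with_status s i c) i <= price_at (with_status s i c') i.
Proof.
move=> cc'; rewrite !price_at_with [X in _ <= X](big_cat_nat (n := c))//= lerDl.
apply: sumr_ge0 => l _.
by rewrite mulr_ge0 ?alloc_incr_ge0//; case/andP: (htau l).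
Qed.

Definition payoff_at s i c (v : R) : R :=
  v * alloc_at (with_status s i c) i - price_at (with_status s i c) i.

Lemma payoff_atE s i c v :
  payoff_at s i c v = \sum_(0 <= l < c) (v - tau l) * alloc_incr s i l.
Proof.
rewrite /payoff_at alloc_at_sum price_at_with mulr_sumr -sumrB.
by apply: eq_bigr => l _; rewrite mulrBl.
Qed.

Lemma payoff_atB s i c c' v : (c <= c')%N ->
  payoff_at s i c' v - payoff_at s i c v =
  \sum_(c <= l < c') (v - tau l) * alloc_incr s i l.
Proof.
move=> cc'; rewrite !payoff_atE [X in X - _](big_cat_nat (n := c))//=.
by rewrite addrAC subrr add0r.
Qed.

Lemma payoff_at_le1 s i c v : (c <= m.+1)%N -> 0 <= v <= 1 ->
  payoff_at s i c v <= 1.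
Proof.
move=> cm /andP[v0 v1]; rewrite /payoff_at.
have := @alloc_at_bounds (with_status s i c) i; rewrite with_status_self.
have /andP[p0 _] := price_at_bounds (with_status s i c) i.
by move=> /(_ cm) /andP[a0 a1]; nra.
Qed.

Lemma payoff_at_ge s i c v : (c <= m.+1)%N -> 0 <= v -> - P <= payoff_at s i c v.
Proof.
move=> cm v0; rewrite /payoff_at.
have := @alloc_at_bounds (with_status s i c) i; rewrite with_status_self.
have /andP[_ p1] := price_at_bounds (with_status s i c) i.
have /andP[t0 /(le_trans t0) P0] := htau 0.
by move=> /(_ cm) /andP[a0 a1]; nra.
Qed.

(** The last step of the sum is charged at [P] and sells at least [alloc_step], while the payoff of
    the lower steps is at most 1. *)
Lemma payoff_at_old s i v : tau m = P -> 1 <= P -> 0 <= v <= 1 ->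
  payoff_at s i m.+1 v <= 1 - (P - 1) * alloc_step.
Proof.
move=> tauP P1 v01.
have /andP[v0 v1] := v01.
have := @payoff_atB s i m m.+1 v (leqnSn m); rewrite big_nat1 tauP => /eqP.
rewrite subr_eq => /eqP ->.
have := @payoff_at_le1 s i m v (leqnSn m) v01.
have := alloc_incr_ge s i m.
have := alloc_step_gt0 i.
by nra.
Qed.

(** * Strict incentives, and efficiency of optimal statuses *)

Context (w : 'I_m -> R) (theta : R).
Context (w_ge0 : forall j, 0 <= w j) (theta_gt0 : 0 < theta).
Context (w_eq0 : forall j : 'I_m, w j = 0 -> j = 0%N :> nat).
Context (tau0 : tau 0 = 0).
Context (tau_low : forall (j : 'I_m) l, (l <= j)%N ->
  ~~ ((l == 0%N) && (w j == 0)) -> theta <= w j - tau l).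
Context (tau_high : forall (j : 'I_m) l, (j < l)%N -> theta <= tau l - w j).

(** A buyer of value 0 is indifferent between status 0 and the status of its type, because the first
    threshold is 0; hence the exception. *)
Definition suboptimal (j : 'I_m) c : bool :=
  (c != j.+1) && ~~ ((c == 0%N) && (w j == 0)).

Lemma payoff_at_optimal s i (j : 'I_m) c : ~~ suboptimal j c ->
  payoff_at s i c (w j) = payoff_at s i j.+1 (w j).
Proof.
rewrite negb_and !negbK => /orP[/eqP -> //|/andP[/eqP -> /eqP wj]].
rewrite (w_eq0 wj) wj !payoff_atE big_nil big_nat1.
by rewrite tau0 subrr mul0r.
Qed.

(** The payoffs of [c] and [j.+1] differ by a sum of terms of one sign, and the term next to [j.+1]
    alone contributes [theta * alloc_step]. *)
Lemma payoff_at_suboptimal s i (j : 'I_m) c : suboptimal j c ->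
  theta * alloc_step <= payoff_at s i j.+1 (w j) - payoff_at s i c (w j).
Proof.
have incr0 l := alloc_incr_ge0 s i l.
move=> /andP[cj]; rewrite negb_and => c0.
have [cltj|] := ltnP c j.+1.
  rewrite payoff_atB ?(ltnW cltj)// big_nat_recr//= -[X in X <= _]add0r.
  apply: lerD.
    rewrite big_nat_cond; apply: sumr_ge0 => l /andP[/andP[_ lj] _].
    have [/andP[/eqP-> /eqP->]|lw] := boolP ((l == 0%N) && (w j == 0)).
      by rewrite tau0 subrr mul0r.
    by rewrite mulr_ge0// (le_trans (ltW theta_gt0))// tau_low// ltnW.
  rewrite ler_pM ?(ltW theta_gt0) ?(ltW (alloc_step_gt0 i)) ?alloc_incr_ge//.
  apply: tau_low => //; rewrite negb_and; case/orP: c0 => [c0|->]; last by rewrite orbT.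
  by rewrite -lt0n (leq_trans _ (_ : c <= j)%N)// lt0n.
rewrite leq_eqVlt eq_sym (negPf cj)/= => jc.
rewrite -opprB payoff_atB ?(ltnW jc)// big_ltn// opprD -[X in X <= _]addr0.
apply: lerD.
  rewrite -mulNr opprB ler_pM ?(ltW theta_gt0) ?(ltW (alloc_step_gt0 i))//.
    exact: tau_high.
  exact: alloc_incr_ge.
rewrite -sumrN big_nat_cond; apply: sumr_ge0 => l /andP[/andP[jl _] _].
rewrite -mulNr opprB mulr_ge0// (le_trans (ltW theta_gt0))// tau_high//.
exact: ltnW.
Qed.

Lemma payoff_at_le_best s i (j : 'I_m) c :
  payoff_at s i c (w j) <= payoff_at s i j.+1 (w j).
Proof.
have [jc|/payoff_at_optimal -> //] := boolP (suboptimal j c).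
rewrite -subr_ge0 (le_trans _ (payoff_at_suboptimal s i jc))//.
by rewrite mulr_ge0 ?(ltW theta_gt0) ?(ltW (alloc_step_gt0 i)).
Qed.

Context (w_incr : forall j k : 'I_m, (j < k)%N -> w j < w k).

(** A buyer of positive highest value must have the status of its type, which no status exceeds
    because statuses are ordered as values. All buyers sharing that status have the same value, so
    the top shares already give weight [1 - eps] to the highest value. *)
Lemma welfare_optimal s (js : 'I_n -> 'I_m) :
  (forall i, (s i <= m.+1)%N) -> (forall i, ~~ suboptimal (js i) (s i)) ->
  (1 - eps) * \big[Num.max/0]_i w (js i) <= \sum_i w (js i) * alloc_at s i.
Proof.
move=> sm opt; have /andP[e0 e1] := heps.
have sum_ge0 : 0 <= \sum_i w (js i) * alloc_at s i.
  by apply: sumr_ge0 => i _; rewrite mulr_ge0//; case/andP: (alloc_at_bounds (sm i)).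
have [i0 _|n0] := pickP (fun _ : 'I_n => true); last first.
  by rewrite big_pred0 ?mulr0.
have [k _ wk] := @eq_bigmax _ _ _ 0 i0 xpredT (w \o js) isT (fun i _ => w_ge0 _).
rewrite wk/=; have lek i : w (js i) <= w (js k).
  by rewrite -[w (js k)]wk; apply: le_bigmax.
have [->|wk0] := eqVneq (w (js k)) 0; first by rewrite mulr0.
have sk : s k = (js k).+1.
  by have := opt k; rewrite negb_and !negbK (negPf wk0) andbF orbF => /eqP.
have s_le i : (s i <= s k)%N.
  have := opt i; rewrite negb_and !negbK => /orP[/eqP->|/andP[/eqP->//]].
  rewrite sk ltnS leqNgt; apply/negP => /w_incr.
  by rewrite ltNge lek.
have s_eq i : s i = s k -> js i = js k.
  have := opt i; rewrite negb_and !negbK => /orP[/eqP->|/andP[/eqP-> _]].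
    by rewrite sk => -[/val_inj].
  by rewrite sk.
set W := [pred i | s i == s k].
have W0 : (0 < #|W|)%N by apply/card_gt0P; exists k; rewrite inE.
rewrite (bigID (fun i => s i == s k))/= -[X in X <= _]addr0; apply: lerD; last first.
  by apply: sumr_ge0 => i _; rewrite mulr_ge0//; case/andP: (alloc_at_bounds (sm i)).
have -> : (1 - eps) * w (js k) = \sum_(i | s i == s k) w (js k) * ((1 - eps) / #|W|%:R).
  rewrite sumr_const -[RHS]mulr_natl.
  have : #|W|%:R != 0 :> R by rewrite pnatr_eq0 -lt0n.
  rewrite [#|_|](_ : _ = #|W|)//; move: (#|W|%:R) => c c0; by field.
apply: ler_sum => i /eqP si; rewrite (s_eq _ si) ler_wpM2l//.
rewrite /alloc_at /top_share si sk/= -sk ifT; last by apply/forallP => j; exact: s_le.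
by rewrite lerDr mulr_ge0 ?divr_ge0 ?(ltW e0).
Qed.

End Mechanism.

(** * The distribution of outcomes *)

Section Update.
Context {I X : finType} {V : nmodType}.

Definition update (f : {ffun I -> X}) i x : {ffun I -> X} :=
  [ffun j => if j == i then x else f j].

Lemma updateE (f : {ffun I -> X}) i x : update f i x i = x.
Proof. by rewrite ffunE eqxx. Qed.

Lemma update_neq (f : {ffun I -> X}) i x j : j != i -> update f i x j = f j.
Proof. by rewrite ffunE => /negPf ->. Qed.

(** Exchanging [x] with the old entry at [i] is an involution of the pairs [(f, x)], so each
    function is hit [#|X|] times. *)
Lemma sum_update i (H : {ffun I -> X} -> V) :
  \sum_f \sum_x H (update f i x) = (\sum_f H f) *+ #|X|.
Proof.
rewrite pair_bigA/=.
pose swap (p : {ffun I -> X} * X) := (update p.1 i p.2, p.1 i).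
have swapK : involutive swap.
  move=> [f x]; rewrite /swap/= updateE; congr pair.
  by apply/ffunP => j; rewrite !ffunE; case: eqVneq => // ->.
rewrite (reindex_inj (inv_inj swapK))/=.
rewrite (eq_bigr (fun p => H p.1)); last first.
  by move=> p _; have := congr1 fst (swapK p) => /= ->.
rewrite -(pair_bigA _ (fun f _ => H f))/= -sumrMnl.
by apply: eq_bigr => f _; rewrite sumr_const.
Qed.

End Update.

Section OutcomeDistribution.
Context {R : realType} {D : value_dist R} {K : arm_set R} {n T : nat}.
Context (A : auction K n T) (fb : 'I_n -> feedback) (S : 'I_n -> strategy D K).
Implicit Types (w : @outcome R D K n T) (t : 'I_T) (i : 'I_n).

Notation profile := {ffun 'I_n -> 'I_(supp_size D) * K}.

Definition expect (F : outcome -> R) : R :=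
  \sum_w outcome_prob A fb S w * F w.

Lemma outcome_prob_ge0 w : 0 <= outcome_prob A fb S w.
Proof.
apply: prodr_ge0 => t _; apply: prodr_ge0 => i _.
by rewrite mulr_ge0 ?pull_prob_ge0// ltW// prob_gt0.
Qed.

Lemma expect_le F G : (forall w, F w <= G w) -> expect F <= expect G.
Proof. by move=> FG; apply: ler_sum => w _; rewrite ler_wpM2l// outcome_prob_ge0. Qed.

Lemma expectD F G : expect (fun w => F w + G w) = expect F + expect G.
Proof. by rewrite -big_split; apply: eq_bigr => w _; rewrite mulrDr. Qed.

Lemma expectZ c F : expect (fun w => c * F w) = c * expect F.
Proof. by rewrite mulr_sumr; apply: eq_bigr => w _; rewrite mulrCA. Qed.

Lemma expectB F G : expect (fun w => F w - G w) = expect F - expect G.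
Proof. by rewrite -sumrB; apply: eq_bigr => w _; rewrite mulrBr. Qed.

Lemma expect_sum (J : Type) (r : seq J) (Q : pred J) (F : J -> outcome -> R) :
  expect (fun w => \sum_(j <- r | Q j) F j w) = \sum_(j <- r | Q j) expect (F j).
Proof.
by rewrite exchange_big/=; apply: eq_bigr => w _; rewrite mulr_sumr.
Qed.

Lemma expect_Pr (E : pred outcome) : expect (fun w => (E w)%:R) = Pr A fb S E.
Proof.
rewrite /Pr big_mkcond; apply: eq_bigr => w _.
by case: (E w); rewrite ?mulr1 ?mulr0.
Qed.

(** * The conditional law of one round and the tower rule *)

Definition round_prob i (h : seq (memory)) (x : 'I_(supp_size D) * K) : R :=
  prob x.1 * pull_prob (S i) h x.1 x.2.

(** Conditional law of the profile of round [t] given the past recorded in [w]; the entries of [w]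
    from [t] on have no influence. *)
Definition step_prob w t (y : profile) : R :=
  \prod_i round_prob i (history A fb w i t) (y i).

Lemma outcome_probE w : outcome_prob A fb S w = \prod_t step_prob w t (w t).
Proof.
by apply: eq_bigr => t _; apply: eq_bigr => i _; rewrite /round_prob ffunE.
Qed.

Lemma round_prob_value i h (j : 'I_(supp_size D)) :
  \sum_(x | x.1 == j) round_prob i h x = prob j.
Proof.
rewrite (eq_bigl (fun x => (x.1 == j) && true)); last by move=> x; rewrite andbT.
rewrite -(pair_big (pred1 j) xpredT (fun a b => prob a * pull_prob (S i) h a b))/=.
by rewrite big_pred1_eq -mulr_sumr pull_prob_sum1 mulr1.
Qed.

Lemma round_prob_sum1 i h : \sum_x round_prob i h x = 1.
Proof.
rewrite -(pair_bigA _ (fun a b => prob a * pull_prob (S i) h a b))/=.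
rewrite -(prob_sum1 D); apply: eq_bigr => j _.
by rewrite -mulr_sumr pull_prob_sum1 mulr1.
Qed.

Lemma step_prob_sum1 w t : \sum_y step_prob w t y = 1.
Proof.
rewrite -(bigA_distr_bigA (fun i => round_prob i (history A fb w i t))).
by rewrite big1// => i _; rewrite round_prob_sum1.
Qed.

(** Measurability with respect to the first [s] rounds. *)
Definition before (s : nat) (V : Type) (F : outcome -> V) : Prop :=
  forall w w', (forall t, (t < s)%N -> w t = w' t) -> F w = F w'.

Lemma before_leq s s' (V : Type) (F : outcome -> V) :
  (s <= s')%N -> before s F -> before s' F.
Proof. by move=> ss' Fs w w' ww'; apply: Fs => t ts; rewrite ww' ?(leq_trans ts). Qed.

Lemma before_history i t : before t (fun w => history A fb w i t).
Proof.
move=> w w' ww'; apply/eq_in_map => u; rewrite mem_filter => /andP[ut _].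
by rewrite /remember /pulls_at /value_at ww'.
Qed.

Lemma before_step_prob t : before t (step_prob ^~ t).
Proof.
move=> w w' ww'; apply/funext => y; apply: eq_bigr => i _.
by rewrite (before_history i ww').
Qed.

Lemma before_update (V : Type) (F : outcome -> V) t y w :
  before t F -> F (update w t y) = F w.
Proof. by apply => u ut; rewrite update_neq// -val_eqE neq_ltn ut. Qed.

Definition prefix_prob (s : nat) w : R := \prod_(t : 'I_T | (t < s)%N) step_prob w t (w t).

Lemma prefix_prob_update w t y :
  prefix_prob t.+1 (update w t y) = prefix_prob t w * step_prob w t y.
Proof.
rewrite /prefix_prob (bigD1 t)//= updateE (before_update y w (@before_step_prob t)).
rewrite mulrC; congr (_ * _); apply: eq_big => u.
  by rewrite ltnS [RHS]ltn_neqAle andbC.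
rewrite ltnS => /andP[ut ut']; rewrite update_neq//.
rewrite (before_update y w (before_leq ut (@before_step_prob u)))//.
Qed.

(** The right side sums over complete outcomes, so each prefix is repeated once for every
    continuation; the power of the number of profiles accounts for this without a division. Rounds
    are summed out from the last one backwards. *)
Lemma expect_prefix k F : (k <= T)%N -> before (T - k) F ->
  expect F *+ #|{: profile}| ^ k = \sum_w prefix_prob (T - k) w * F w.
Proof.
elim: k => [_ _|k IHk kT Fk].
  rewrite subn0 expn0 mulr1n; apply: eq_bigr => w _; congr (_ * _).
  by rewrite outcome_probE; apply: eq_bigl => t; rewrite ltn_ord.
have kT' : (T - k.+1 < T)%N by rewrite ltn_subrL (leq_trans _ kT).
pose t := Ordinal kT'.
have Tk : (T - k = t.+1)%N by rewrite /= subnSK.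
rewrite expnSr mulrnA IHk ?(ltnW kT)//; last by apply: before_leq Fk; rewrite leq_sub2l.
rewrite -(sum_update t (fun w => _ w * F w))/=; apply: eq_bigr => w _.
rewrite (eq_bigr (fun y => prefix_prob t w * F w * step_prob w t y)); last first.
  by move=> y _; rewrite Tk prefix_prob_update (before_update (t := t) y w Fk) mulrAC.
by rewrite -mulr_sumr step_prob_sum1 mulr1.
Qed.

Lemma profile_card_gt0 : (0 < #|{: profile}|)%N.
Proof.
have [j _|D0] := pickP (fun _ : 'I_(supp_size D) => true).
  by apply/card_gt0P; exists [ffun=> (j, null_arm K)].
by have /eqP := prob_sum1 D; rewrite big_pred0// eq_sym oner_eq0.
Qed.

Lemma expect1 : expect (fun=> 1) = 1.
Proof.
have := @expect_prefix T (fun=> 1) (leqnn _) (fun _ _ _ => erefl).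
rewrite subnn; under eq_bigr do rewrite mulr1 /prefix_prob big_pred0_eq.
have -> : \sum_(w : @outcome R D K n T) 1 = 1 *+ #|{: profile}| ^ T :> R.
  by rewrite sumr_const [X in _ *+ X = _]card_ffun card_ord.
apply: pmulrnI.
by rewrite expn_gt0 profile_card_gt0.
Qed.

Lemma expect_cst c : expect (fun=> c) = c.
Proof. by have := expectZ c (fun=> 1); rewrite expect1 mulr1. Qed.

(** Tower rule: the profile of round [t] is redrawn from its conditional law given the past. *)
Lemma expect_step t F : before t.+1 F ->
  expect F = expect (fun w => \sum_y step_prob w t y * F (update w t y)).
Proof.
move=> Ft; set F' := (X in _ = expect X).
have F't : before t F'.
  move=> w w' ww'; apply: eq_bigr => y _; rewrite (before_step_prob ww').
  congr (_ * _); apply: Ft => u; rewrite ltnS leq_eqVlt => /predU1P[/val_inj ->|ut].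
    by rewrite !updateE.
  by rewrite !update_neq ?ww'// -val_eqE neq_ltn ut.
have tT := ltn_ord t.
(* Both sides are written with prefix weights, of lengths [t] and [t.+1]; their multiplicities
   differ by one factor, the number of profiles, which [sum_update] supplies. *)
have := @expect_prefix (T - t) F' (leq_subr _ _); rewrite subKn ?(ltnW tT)// => /(_ F't).
have := @expect_prefix (T - t.+1) F (leq_subr _ _); rewrite subKn// => /(_ Ft).
move=> /(congr1 (fun x => x *+ #|{: profile}|)).
rewrite -mulrnA -expnSr subnSK// -(sum_update t (fun w => _ w * F w))/=.
have -> : \sum_w \sum_y prefix_prob t.+1 (update w t y) * F (update w t y) =
    \sum_w prefix_prob t w * F' w.
  apply: eq_bigr => w _; rewrite mulr_sumr; apply: eq_bigr => y _.
  by rewrite prefix_prob_update mulrA.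
move=> <- /pmulrnI -> //.
by rewrite expn_gt0 profile_card_gt0.
Qed.

(** * Independence of the current values *)

Lemma expect_values t (g : ('I_n -> 'I_(supp_size D)) -> R) :
  expect (fun w => g (value_at w t)) =
  \sum_(f : {ffun 'I_n -> 'I_(supp_size D)}) (\prod_i prob (f i)) * g f.
Proof.
rewrite (@expect_step t); last first.
  by move=> w w' ww'; congr g; apply/funext => i; rewrite /value_at ww'.
set c := RHS; rewrite -[RHS]expect_cst; congr expect; apply/funext => w.
rewrite (partition_big (fun y : profile => [ffun i => (y i).1]) xpredT)//=.
apply: eq_bigr => f _.
transitivity (\sum_(y in family (fun i => [pred x | x.1 == f i]))
    step_prob w t y * g f).
  apply: eq_big => [y|y /eqP <-].
    apply/eqP/familyP => [<- i|yf]; first by rewrite inE ffunE.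
    by apply/ffunP => i; rewrite ffunE; apply/eqP; have := yf i; rewrite inE.
  by congr (_ * g _); apply/funext => i; rewrite /value_at updateE ffunE.
rewrite -mulr_suml; congr (_ * _).
rewrite -(bigA_distr_big_dep (fun i x => x.1 == f i)
  (fun i => round_prob i (history A fb w i t))).
by apply: eq_bigr => i _; rewrite round_prob_value.
Qed.

(** The law of a round is a product over buyers, and a value is drawn before the arm. Hence the
    value of buyer [i] is independent of whatever depends only on the past and on the other buyers'
    entries of round [t]. *)
Lemma expect_indep t i (j : 'I_(supp_size D)) F : before t.+1 F ->
  (forall w (y y' : profile), (forall i', i' != i -> y i' = y' i') ->
     F (update w t y) = F (update w t y')) ->
  expect (fun w => (value_at w t i == j)%:R * F w) = prob j * expect F.
Proof.
move=> Ft Fi; rewrite (@expect_step t); last first.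
  by move=> w w' ww'; rewrite /value_at ww'// (Ft _ _ ww').
rewrite (expect_step Ft) -expectZ; congr expect; apply/funext => w.
have card_gt0 : (0 < #|{: 'I_(supp_size D) * K}|)%N.
  by apply/card_gt0P; exists (j, null_arm K).
pose rest y := \prod_(i' | i' != i) round_prob i' (history A fb w i' t) (y i').
have stepE y x : step_prob w t (update y i x) =
    round_prob i (history A fb w i t) x * rest y.
  rewrite /step_prob (bigD1 i)//= updateE; congr (_ * _).
  by apply: eq_bigr => i' i'i; rewrite update_neq.
have FE y x : F (update w t (update y i x)) = F (update w t y).
  by apply: Fi => i' i'i; rewrite update_neq.
(* Averaging over redraws of the entry of buyer [i] alone isolates its factor; [F] and [rest] are
   unaffected. *)
apply: (pmulrnI card_gt0); rewrite -mulrnAr.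
rewrite -(sum_update i (fun y => step_prob w t y * F (update w t y))).
rewrite -(sum_update i (fun y => step_prob w t y * (_ * F (update w t y)))).
rewrite mulr_sumr; apply: eq_bigr => y _.
rewrite (eq_bigr (fun x => (x.1 == j)%:R * round_prob i (history A fb w i t) x
    * (rest y * F (update w t y)))); last first.
  move=> x _; rewrite FE stepE /value_at !updateE; ring.
rewrite -mulr_suml; under [X in X * _]eq_bigr do rewrite mulrC mulr_natr mulrb.
rewrite -big_mkcond round_prob_value; congr (_ * _).
rewrite (eq_bigr (fun x => round_prob i (history A fb w i t) x
    * (rest y * F (update w t y)))); last by move=> x _; rewrite FE stepE mulrA.
by rewrite -mulr_suml round_prob_sum1 mul1r.
Qed.

End OutcomeDistribution.

(** * Sessions *)

Section Rounds.
Context {R : realType} {T : nat}.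
Implicit Types (t u : 'I_T) (Q : pred 'I_T).

Lemma sum_ltS (V : nmodType) (F : 'I_T -> V) Q t :
  \sum_(u : 'I_T | (u < t.+1)%N && Q u) F u =
  \sum_(u : 'I_T | (u < t)%N && Q u) F u + (if Q t then F t else 0).
Proof.
rewrite big_mkcond (bigD1 t)//= leqnn andTb addrC; congr (_ + _).
rewrite [RHS]big_mkcond [RHS](bigD1 t)//= ltnn/= add0r.
apply: eq_bigr => u ut; rewrite ltnS leq_eqVlt.
by rewrite val_eqE (negPf ut).
Qed.

(* The sum moves up by at least [eta] in each round of [Q], so the clamp of the
   sum to [lo, hi + eta] gains [eta] in each counted round. *)
Lemma card_window Q (d : 'I_T -> R) (c0 eta lo hi : R) : 0 <= eta -> lo <= hi ->
  (forall t, Q t -> eta <= d t) ->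
  eta * #|[pred t | Q t
           && (lo <= c0 + \sum_(u : 'I_T | (u < t)%N && Q u) d u <= hi)]|%:R
    <= hi - lo + eta.
Proof.
move=> eta0 lohi dQ.
set X := fun s : nat => c0 + \sum_(u : 'I_T | (u < s)%N && Q u) d u.
set W := fun t => Q t && (lo <= X t <= hi).
have claim s : (s <= T)%N -> \sum_(t : 'I_T | (t < s)%N && W t) eta <=
    Num.min (Num.max (X s) lo) (hi + eta) - lo.
  elim: s => [_|s IHs sT].
    rewrite big_pred0// subr_ge0 le_min le_max lexx orbT/=; lra.
  have := IHs (ltnW sT); rewrite -[s]/(nat_of_ord (Ordinal sT)); set t := Ordinal sT.
  rewrite /= !(sum_ltS _ _ t).
  have -> : X t.+1 = X t + (if Q t then d t else 0) by rewrite /X (sum_ltS _ _ t) addrA.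
  rewrite [W t]/(Q t && _); have := dQ t; case: (Q t) => [/(_ isT)|_] /=; last by rewrite !addr0.
  move: (X t) (d t) (\sum_(_ | _) _) => x y z etay IH.
  move: IH; rewrite !lerBrDr !le_min !le_max => /andP[xlo xhi].
  case: ifP => [/andP[lox hix]|_].
    apply/andP; split; last by case/orP: xlo; lra.
    by apply/orP; left; case/orP: xlo; lra.
  rewrite addr0 xhi andbT; case/orP: xlo => [xlo|->]; last by rewrite orbT.
  by apply/orP; left; lra.
have := claim T (leqnn T); rewrite (eq_bigl W); last by move=> t; rewrite ltn_ord.
rewrite sumr_const -[_ *+ _]mulr_natr => /le_trans; apply.
have : Num.min (Num.max (X T) lo) (hi + eta) <= hi + eta by rewrite ge_min lexx orbT.
lra.
Qed.

End Rounds.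

(** * Blocks of arms and blocks of rounds *)

Section Sessions.
Context (N m : nat).
Implicit Types (k b : nat).

(* At session [k] the arms split, by increasing label, into arms not yet
   opened (status 0), the arms of the [m] types (statuses 1 to m) and the
   arms of former sessions (status m+1). *)
Definition status k b : nat := minn (b - (N.-1 - k) * m) m.+1.

(** Blocks of [m] arms are opened from the highest labels downwards, so that arms of former sessions
    carry the larger labels, as monotonicity demands of arms that win more and pay more. *)
Definition best_arm k j : nat := ((N.-1 - k) * m + j).+1.

Lemma status_le k b : (status k b <= m.+1)%N.
Proof. exact: geq_minr. Qed.

Lemma status0 k : status k 0 = 0%N.
Proof. by rewrite /status sub0n min0n. Qed.

Lemma status_mono k b b' : (b <= b')%N -> (status k b <= status k b')%N.
Proof. by move=> bb'; rewrite /status leq_min geq_minr andbT geq_min leq_sub2r. Qed.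

Lemma status_best k j : (j < m)%N -> status k (best_arm k j) = j.+1.
Proof. by move=> jm; rewrite /status /best_arm -addnS addKn; apply/minn_idPl; lia. Qed.

Lemma best_arm_le k j : (k < N)%N -> (j < m)%N -> (best_arm k j <= N * m)%N.
Proof.
move=> kN jm; rewrite /best_arm -addnS.
apply: (@leq_trans ((N.-1 - k).+1 * m)); first by rewrite mulSn addnC leq_add2r.
by rewrite leq_mul2r; apply/orP; right; lia.
Qed.

(** The block of an earlier session starts above every arm that is unopened or current in session
    [k]. *)
Lemma status_earlier k k' b : (k' < k < N)%N -> (status k b <= m)%N ->
  status k' b = 0%N.
Proof.
move=> /andP[k'k kN]; rewrite /status geq_min ltnn orbF leq_subLR => bk.
suff /eqP -> : (b - (N.-1 - k') * m == 0)%N by rewrite min0n.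
rewrite subn_eq0 (leq_trans bk)// -mulSnr leq_mul2r; apply/orP; right; lia.
Qed.

Definition session T t : nat := (t * N %/ T)%N.

Lemma session_lt T (t : 'I_T) : (0 < N)%N -> (session T t < N)%N.
Proof.
by move=> N0; rewrite /session ltn_divLR ?(leq_ltn_trans _ (ltn_ord t))// mulnC ltn_pmul2l.
Qed.

Lemma session_mono T t t' : (t <= t')%N -> (session T t <= session T t')%N.
Proof. by move=> tt'; rewrite leq_div2r// leq_mul2r tt' orbT. Qed.

Lemma card_session {R : realType} T k : (0 < N)%N ->
  #|[pred t : 'I_T | session T t == k]|%:R <= T%:R / N%:R + 1 :> R.
Proof.
move=> N0; have N0' : 0 < N%:R :> R by rewrite ltr0n.
(* The multiples [t * N] grow by [N] per round and stay in a window of length [T] during session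
   [k]. *)
have := @card_window R T xpredT (fun=> N%:R) 0 N%:R (k * T)%:R (k.+1 * T)%:R.
rewrite ler0n ler_nat leq_mul2r leqnSn orbT => /(_ isT isT (fun _ _ => lexx _)).
set W := [pred t | _] => cardW.
have /subset_leq_card : [pred t : 'I_T | session T t == k] \subset W.
  apply/fintype.subsetP => t; rewrite !inE/= => /eqP tk.
  have -> : 0 + \sum_(u : 'I_T | (u < t)%N && true) (N%:R : R) = (t * N)%:R.
    rewrite add0r (eq_bigl (fun u : 'I_T => (u < t)%N)); last by move=> u; rewrite andbT.
    by rewrite (big_ord_narrow (ltnW (ltn_ord t))) sumr_const card_ord -mulrnA mulnC.
  rewrite !ler_nat -tk /session leq_trunc_div/=.
  by rewrite ltnW// ltn_ceil// (leq_ltn_trans _ (ltn_ord t)).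
rewrite -(ler_nat R) => /le_trans; apply.
rewrite -(ler_pM2l N0') (le_trans cardW)// mulSn natrD mulrDr mulr1.
rewrite [N%:R * _]mulrC divfK ?gt_eqF//; lra.
Qed.

End Sessions.

(** * Scores of the arms *)

Section Dynamics.
Context {R : realType} (T N m j : nat) (rho : 'I_T -> nat -> R) (subopt : pred nat).
Context (eta H P L : R).
Implicit Types (t u : 'I_T) (b : 'I_(N * m).+1) (c k s : nat).
Context (N_gt0 : (0 < N)%N) (jm : (j < m)%N).
Context (eta_gt0 : 0 < eta) (H_gt0 : 0 < H).
Context (rho0 : forall t, rho t 0 = 0).
Context (rho_subopt : forall t c, subopt c -> eta <= rho t j.+1 - rho t c).
Context (rho_opt : forall t c, ~~ subopt c -> rho t c = rho t j.+1).
Context (rho_le1 : forall t c, (c <= m.+1)%N -> rho t c <= 1).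
Context (rho_ge : forall t c, (c <= m.+1)%N -> - P <= rho t c).
Context (rho_old : forall t, rho t m.+1 <= - H).
Context (card_sessionL : forall k, #|[pred t : 'I_T | session N T t == k]|%:R <= L).

Notation sess := (session N T).
Notation stat := (status N m).

(** Cumulative payoff for one fixed buyer and one fixed type [j], whatever the actual values; it is
    the [sigma] of the mean-based condition. *)
Definition score s b : R :=
  \sum_(t : 'I_T | (t < s)%N) rho t (stat (sess t) b).

Definition best k : 'I_(N * m).+1 := inord (best_arm N m k j).

Definition elapsed t : R := #|[pred u : 'I_T | (u < t)%N && (sess u == sess t)]|%:R.

Lemma rho_le_best t c : rho t c <= rho t j.+1.
Proof.
have [/(rho_subopt t)|/(rho_opt t)->//] := boolP (subopt c).
by move/(le_trans (ltW eta_gt0)); rewrite subr_ge0.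
Qed.

Lemma rho_best_ge0 t : 0 <= rho t j.+1.
Proof. by rewrite -(rho0 t) rho_le_best. Qed.

Lemma sess_lt t : (sess t < N)%N. Proof. exact: session_lt. Qed.

Lemma bestE k : (k < N)%N -> best k = best_arm N m k j :> nat.
Proof. by move=> kN; rewrite inordK// ltnS best_arm_le. Qed.

Lemma status_best_sess t : stat (sess t) (best (sess t)) = j.+1.
Proof. by rewrite bestE ?sess_lt// status_best. Qed.

Lemma sess_before t u : (u < t)%N -> (sess u < sess t)%N = (sess u != sess t).
Proof. by move=> ut; rewrite ltn_neqAle session_mono ?andbT// ltnW. Qed.

Lemma status_before t u b : (u < t)%N -> sess u != sess t ->
  (stat (sess t) b <= m)%N -> stat (sess u) b = 0%N.
Proof.
move=> ut ne; apply: status_earlier.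
by rewrite sess_before// ne sess_lt.
Qed.

Lemma elapsedE t : elapsed t = \sum_(u : 'I_T | (u < t)%N) (sess u == sess t)%:R.
Proof.
rewrite /elapsed -sum1_card natr_sum big_mkcondr/=; apply: eq_bigr => u _.
by case: eqP.
Qed.

(** Arms not yet retired had status 0 in all earlier sessions, so only the rounds of the current
    session tell them apart. *)
Lemma score_new t b : (stat (sess t) b <= m)%N -> subopt (stat (sess t) b) ->
  score t b <= score t (best (sess t)) - eta * elapsed t.
Proof.
move=> bm bsub; rewrite elapsedE mulr_sumr -sumrB; apply: ler_sum => u ut.
have [->|ne] := eqVneq (sess u) (sess t).
  by rewrite status_best_sess mulr1 lerBrDr addrC -lerBrDr rho_subopt.
rewrite mulr0 subr0 (status_before ut ne bm).
by rewrite (status_before ut ne) ?status_best_sess// ltnS.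
Qed.

Lemma score_new_le t b : (stat (sess t) b <= m)%N ->
  score t b <= score t (best (sess t)).
Proof.
move=> bm; apply: ler_sum => u ut.
have [->|ne] := eqVneq (sess u) (sess t); first by rewrite status_best_sess rho_le_best.
rewrite (status_before ut ne bm).
by rewrite (status_before ut ne) ?status_best_sess.
Qed.

Lemma score_best_ge0 t : 0 <= score t (best (sess t)).
Proof.
apply: sumr_ge0 => u ut.
have [->|ne] := eqVneq (sess u) (sess t); first by rewrite status_best_sess rho_best_ge0.
by rewrite (status_before ut ne) ?rho0 ?status_best_sess.
Qed.

(** An arm is active in at most one session, where it gains at most 1 per round; before, it pays 0,
    and afterwards at most [- H]. *)
Lemma score_le s b :
  score s b <= L - H * \sum_(t : 'I_T | (t < s)%N) (stat (sess t) b == m.+1)%:R.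
Proof.
pose active t := (0 < stat (sess t) b <= m)%N.
have le_active : \sum_(t : 'I_T | (t < s)%N) (active t)%:R <= L.
  rewrite big_mkcond/= (le_trans (y := \sum_t (active t)%:R))//.
    by apply: ler_sum => t _; case: ifP.
  have [t0 t0a|noact] := pickP active; last first.
    rewrite big1 => [|t _]; last by rewrite noact.
    exact: le_trans (card_sessionL 0).
  apply: le_trans (card_sessionL (sess t0)).
  rewrite -natr_sum -sum1_card ler_nat [X in (_ <= X)%N]big_mkcond/=.
  apply: leq_sum => t _; have [ta|//] := boolP (active t).
  have /andP[tg tm] := ta; have /andP[t0g t0m] := t0a.
  suff tt0 : sess t = sess t0 by rewrite unfold_in /= tt0 eqxx.
  have [lt|lt|//] := ltngtP (sess t) (sess t0).
    by move: tg; rewrite (status_earlier (k := sess t0))// lt sess_lt.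
  by move: t0g; rewrite (status_earlier (k := sess t))// lt sess_lt.
rewrite (le_trans _ (lerB le_active (lexx _)))// mulr_sumr -sumrB.
apply: ler_sum => t _; rewrite /active.
have := status_le N m (sess t) b; rewrite leq_eqVlt => /predU1P[->|].
  by rewrite eqxx ltnn mulr1 sub0r rho_old.
rewrite ltnS => tm; rewrite tm andbT (ltn_eqF (n := m.+1))// mulr0 subr0.
by case: posnP => [->|_]; rewrite ?rho0// rho_le1// (leq_trans tm).
Qed.

Lemma score_leL s b : score s b <= L.
Proof.
apply: le_trans (score_le s b) _; rewrite lerBlDr lerDl mulr_ge0 ?(ltW H_gt0)//.
exact: sumr_ge0.
Qed.

Lemma score_former t b : stat (sess t) b = m.+1 -> score t b <= L - H * elapsed t.
Proof.
move=> tb; apply: le_trans (score_le t b) _.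
rewrite lerD2l lerN2 ler_wpM2l ?(ltW H_gt0)// elapsedE; apply: ler_sum => u _.
by have [->|] := eqVneq (sess u) (sess t); rewrite ?tb ?eqxx ?ler0n.
Qed.

(** * Lagging arms and undecided rounds *)

Context (G : R) (G_ge0 : 0 <= G).

(** [X] rounds suffice both to wear down the score of a former arm, at most [L], and to build up a
    lead over the arms not yet retired. *)
Lemma subopt_lags (X : R) t b : L + G <= H * X -> G <= eta * X ->
  X < elapsed t -> subopt (stat (sess t) b) ->
  score t b < score t (best (sess t)) - G.
Proof.
move=> LGX GX Xt bsub; have best0 := score_best_ge0 t.
have := status_le N m (sess t) b; rewrite leq_eqVlt ltnS => /predU1P[/score_former le_b|bm].
  have : H * X < H * elapsed t by rewrite ltr_pM2l.
  lra.
have := score_new bm bsub.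
have : eta * X < eta * elapsed t by rewrite ltr_pM2l.
lra.
Qed.

Definition near_best t b : bool := [forall b' : 'I_(N * m).+1, score t b' - G <= score t b].

(** In all other rounds the near-best arms, the leader included, have one and the same current
    payoff. *)
Definition undecided t : bool := [exists b : 'I_(N * m).+1, exists b' : 'I_(N * m).+1,
  [&& near_best t b, near_best t b'
    & rho t (stat (sess t) b) != rho t (stat (sess t) b')]].

(* Only arms of former sessions, which all pay the same, can be ahead of the
   best arm of the current session. *)
Lemma undecided_crossing t : undecided t -> exists2 b : 'I_(N * m).+1, subopt (stat (sess t) b) &
  - G <= score t (best (sess t)) - score t b <= G.
Proof.
have cross b b' : near_best t b -> near_best t b' ->
    rho t (stat (sess t) b) != rho t (stat (sess t) b') ->
    subopt (stat (sess t) b) -> - G <= score t (best (sess t)) - score t b <= G.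
  move=> /forallP nb /forallP nb' ne _.
  have := nb (best (sess t)); rewrite lerBlDr -lerBlDl => -> /=; rewrite andbT.
  rewrite leNgt; apply/negP => lt_b.
  have old b1 : score t (best (sess t)) < score t b1 -> stat (sess t) b1 = m.+1.
    move=> lt1; apply/eqP; rewrite eqn_leq status_le ltnNge; apply/negP => /score_new_le.
    by rewrite leNgt lt1.
  move: ne; rewrite !old ?eqxx//; first by move: (nb' b); lra.
  by move: G_ge0; lra.
move=> /existsP[b /existsP[b' /and3P[nb nb' ne]]].
have [bs|/(rho_opt t) bo] := boolP (subopt (stat (sess t) b)).
  by exists b => //; apply: cross nb nb' ne bs.
have [bs|/(rho_opt t) bo'] := boolP (subopt (stat (sess t) b')).
  by exists b' => //; apply: cross nb' nb _ bs; rewrite eq_sym.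
by move: ne; rewrite bo bo' eqxx.
Qed.

(** During session [k] the difference of the two scores rises by at least [eta] per round, so it
    crosses the window from [- G] to [G] quickly, whatever value earlier sessions left. *)
Lemma card_crossing k b :
  eta * #|[pred t : 'I_T | [&& sess t == k, subopt (stat k b)
    & - G <= score t (best k) - score t b <= G]]|%:R <= 2 * G + eta.
Proof.
have [bs|bs] := boolP (subopt (stat k b)); last first.
  rewrite (eq_card0 (A := [pred t : 'I_T | _])) ?mulr0; last by move=> t; rewrite !inE andbF.
  by rewrite addr_ge0 ?mulr_ge0 ?(ltW eta_gt0).
have [k_lt|kN] := ltnP k N; last first.
  rewrite (eq_card0 (A := [pred t : 'I_T | _])) ?mulr0.
    by rewrite addr_ge0 ?mulr_ge0 ?(ltW eta_gt0).
  by move=> t; rewrite !inE ltn_eqF// (leq_trans (sess_lt t)).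
pose d (t : 'I_T) := rho t (stat (sess t) (best k)) - rho t (stat (sess t) b).
have dQ (t : 'I_T) : sess t == k -> eta <= d t.
  by move=> /eqP tk; rewrite /d -[in best _]tk status_best_sess rho_subopt// tk.
have GG : - G <= G by move: G_ge0; lra.
have := card_window (\sum_(u : 'I_T | (sess u < k)%N) d u) (ltW eta_gt0) GG dQ.
rewrite opprK [2 * G]mulrDl mul1r; apply: le_trans.
rewrite (ler_pM2l eta_gt0) ler_nat; apply: subset_leq_card.
apply/fintype.subsetP => t; rewrite !inE/= => /andP[tk]; rewrite tk/=.
suff -> : score t (best k) - score t b =
    \sum_(u : 'I_T | (sess u < k)%N) d u +
    \sum_(u : 'I_T | (u < t)%N && (sess u == k)) d u by [].
rewrite /score -sumrB (bigID (fun u : 'I_T => sess u == k))/= addrC.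
congr (_ + _); apply: eq_bigl => u.
have [ut|] := ltnP u t; first by rewrite -(eqP tk) sess_before.
by move=> /(session_mono N T); rewrite (eqP tk) leqNgt => /negPf ->.
Qed.

(** Union bound over sessions and arms: every undecided round is a crossing for some pair. *)
Lemma card_undecided : eta * #|undecided|%:R <=
  N%:R * (N * m).+1%:R * (2 * G + eta).
Proof.
rewrite -sum1_card natr_sum.
apply: (@le_trans _ _ (eta * \sum_(k < N) \sum_(b < (N * m).+1) \sum_(t : 'I_T | [&& sess t == k,
    subopt (stat k b) & - G <= score t (best k) - score t b <= G]) 1)).
  rewrite ler_pM2l//; under [X in _ <= X]eq_bigr do
    under eq_bigr do rewrite big_mkcond.
  under [X in _ <= X]eq_bigr do rewrite exchange_big/=.
  rewrite [X in _ <= X]exchange_big/= big_mkcond/=; apply: ler_sum => t _.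
  rewrite /in_mem/=; case: ifP => [/undecided_crossing[b bs bG]|_]; last first.
    by apply: sumr_ge0 => k _; apply: sumr_ge0 => b _; case: ifP.
  rewrite (bigD1 (Ordinal (sess_lt t)))//= (bigD1 b)//= eqxx bs bG/= -addrA lerDl.
  by rewrite addr_ge0 ?sumr_ge0// => *; rewrite ?sumr_ge0// => *; case: ifP.
rewrite mulr_sumr -mulrA -[X in _ <= X%:R * _]card_ord mulr_natl -sumr_const.
apply: ler_sum => k _; rewrite mulr_sumr -[X in _ <= X%:R * _]card_ord mulr_natl -sumr_const.
by apply: ler_sum => b _; rewrite sumr_const card_crossing.
Qed.

(** * Growth of the maximal score *)

Definition top_score s : R := score s [arg max_(b > (ord0 : 'I_(N * m).+1) | xpredT b) score s b]%O.

Lemma score_le_top s b : score s b <= top_score s.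
Proof. by rewrite /top_score; case: arg_maxP => // b' _; apply. Qed.

Lemma top_score_le s : top_score s <= L.
Proof. exact: score_leL. Qed.

Lemma top_score0 : top_score 0 = 0.
Proof. by rewrite /top_score /score big_pred0. Qed.

Lemma scoreS t b : score t.+1 b = score t b + rho t (stat (sess t) b).
Proof.
have := sum_ltS (fun u => rho u (stat (sess u) b)) xpredT t.
by rewrite /score; under eq_bigl do rewrite andbT; under [X in _ = X + _]eq_bigl do rewrite andbT.
Qed.

(** A near-best arm pays what the leader pays, and the leader's next score bounds the next maximum
    from below. *)
Lemma rho_le_gain t b : near_best t b -> ~~ undecided t ->
  rho t (stat (sess t) b) <= top_score t.+1 - top_score t.
Proof.
move=> nb /existsPn/(_ b)/existsPn.
have [b' top_b' nb'] : exists2 b', top_score t = score t b' & near_best t b'.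
  exists [arg max_(b' > (ord0 : 'I_(N * m).+1) | xpredT b') score t b']%O => //.
  apply/forallP => b1; rewrite lerBlDr (le_trans (score_le_top t b1))// lerDl//.
move=> /(_ b'); rewrite nb nb'/= negbK => /eqP ->.
by rewrite top_b' lerBrDl -scoreS score_le_top.
Qed.

Lemma gain_ge t : - P <= top_score t.+1 - top_score t.
Proof.
rewrite lerBrDl /top_score; set b := (X in score t X).
by apply: le_trans (score_le_top t.+1 b); rewrite scoreS lerD2l rho_ge// status_le.
Qed.

End Dynamics.

(** * The repeated auction *)

Section Auction.
Context {R : realType} (n N m : nat) (eps P : R) (tau : nat -> R).
Context (n_gt0 : (0 < n)%N) (heps : 0 < eps < 1) (P_ge1 : 1 <= P).
Context (htau : forall l, 0 <= tau l <= P).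

(** Labels above [P] make prices up to [P] times the allocation admissible. *)
Definition arm_label (b : 'I_(N * m).+1) : R :=
  if b == 0%N :> nat then 0 else P + b%:R.

Lemma arm_label_gtE b b' : arm_label b < arm_label b' -> (b < b')%N.
Proof.
rewrite /arm_label; case: posnP => [b0|_]; case: posnP => [b'0|b'0]; rewrite ?ltxx//.
- by rewrite b0.
- by rewrite ltNge addr_ge0 ?ler0n// (le_trans ler01).
- by rewrite ltrD2l ltr_nat.
Qed.

Lemma arm_label_inj : injective arm_label.
Proof.
move=> b b'; rewrite /arm_label; case: posnP => [b0|b0]; case: posnP => [b'0|b'0] E;
  apply: val_inj.
- by rewrite /= b0 b'0.
- by move/eqP: E; rewrite lt_eqF// ltr_wpDr// (lt_le_trans ltr01).
- by move/eqP: E; rewrite gt_eqF// ltr_wpDr// (lt_le_trans ltr01).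
- by move/addrI/eqP: E; rewrite eqr_nat => /eqP.
Qed.

Lemma arm_label_ge0 b : 0 <= arm_label b.
Proof. by rewrite /arm_label; case: ifP => // _; rewrite addr_ge0 ?ler0n// (le_trans ler01). Qed.

Definition session_arms : arm_set R :=
  @ArmSet R 'I_(N * m).+1 arm_label arm_label_inj arm_label_ge0 ord0 erefl.

Context (T : nat).
Implicit Types (t : 'I_T) (bs : bids session_arms n) (i : 'I_n) (b : session_arms).

Definition statuses t bs : 'I_n -> nat :=
  fun i => status N m (session N T t) (bs i : 'I_(N * m).+1).

Lemma statuses_deviate t bs i b : statuses t (deviate bs i b) =
  with_status (statuses t bs) i (status N m (session N T t) (b : 'I_(N * m).+1)).
Proof. by apply/funext => i'; rewrite /statuses /with_status ffunE; case: eqP. Qed.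

Lemma statuses_permute t bs (s : {perm 'I_n}) :
  statuses t (permute bs s) = statuses t bs \o s.
Proof. by apply/funext => i; rewrite /statuses ffunE. Qed.

Lemma statuses_le t bs i : (statuses t bs i <= m.+1)%N.
Proof. exact: status_le. Qed.

Definition session_alloc t bs i : R := alloc_at m eps (statuses t bs) i.
Definition session_price t bs i : R := price_at m eps tau (statuses t bs) i.

Lemma session_price_bounds t bs i :
  0 <= session_price t bs i <= label (bs i) * session_alloc t bs i.
Proof.
rewrite /session_price /session_alloc.
have /andP[-> /= le_p] := price_at_bounds m heps htau (statuses t bs) i.
apply: le_trans le_p _; rewrite /= /arm_label; case: eqP => [b0|_].
  by rewrite alloc_at0 ?mulr0// /statuses b0 status0.
have /andP[a0 _] := alloc_at_bounds heps (statuses_le t bs i).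
by rewrite ler_wpM2r// lerDl.
Qed.

Lemma session_alloc_null t bs i :
  bs i = null_arm session_arms -> session_alloc t bs i = 0.
Proof. by move=> b0; rewrite /session_alloc alloc_at0// /statuses b0 status0. Qed.

Definition session_auction : auction session_arms n T.
Proof.
apply: (@Auction R session_arms n T session_alloc session_price).
- by move=> t bs i; exact: alloc_at_bounds (statuses_le t bs i).
- by move=> t bs; exact: alloc_at_feasible (statuses_le t bs).
- exact: session_price_bounds.
- exact: session_alloc_null.
- by move=> t bs s i; rewrite /session_alloc statuses_permute alloc_at_perm.
- by move=> t bs s i; rewrite /session_price statuses_permute price_at_perm.
- move=> t bs i b b' /arm_label_gtE /ltnW bb'.
  by rewrite /session_alloc !statuses_deviate alloc_at_mono ?status_mono.
- move=> t bs i b b' /arm_label_gtE /ltnW bb'.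
  by rewrite /session_price !statuses_deviate (price_at_mono _ heps htau)// status_mono.
Defined.

Lemma session_payoffE t bs i b v : payoff session_auction t bs i b v =
  payoff_at m eps tau (statuses t bs) i
    (status N m (session N T t) (b : 'I_(N * m).+1)) v.
Proof.
by rewrite /payoff /= /session_alloc /session_price statuses_deviate.
Qed.

End Auction.

(** * Revenue *)

(** The status of buyer [i] is overwritten in every term. This is what later makes scores
    independent of the buyer's own pulls. *)
Lemma payoff_at_others {R : realType} {n : nat} (m : nat) (eps : R) (tau : nat -> R)
    (s s' : 'I_n -> nat) (i : 'I_n) (c : nat) (v : R) :
  (forall i', i' != i -> s i' = s' i') ->
  payoff_at m eps tau s i c v = payoff_at m eps tau s' i c v.
Proof.
move=> ss'; have E l : with_status s i l = with_status s' i l.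
  by apply/funext => i'; rewrite /with_status; case: eqVneq => // /ss'.
rewrite /payoff_at !price_at_with !E; congr (_ - _).
by apply: eq_bigr => l _; rewrite /alloc_incr !E.
Qed.

Section Revenue.
Context {R : realType} (D : value_dist R) (n N : nat) (eps P : R) (tau : nat -> R).
Notation m := (supp_size D).
Context (n_gt0 : (0 < n)%N) (N_gt0 : (0 < N)%N) (heps : 0 < eps < 1) (P_ge1 : 1 <= P).
Context (htau : forall l, 0 <= tau l <= P).
Context (theta H : R) (theta_gt0 : 0 < theta) (H_gt0 : 0 < H).
Context (tau0 : tau 0 = 0) (tauP : tau m = P).
Context (tau_low : forall (j : 'I_m) l, (l <= j)%N ->
  ~~ ((l == 0%N) && (value j == 0)) -> theta <= value j - tau l).
Context (tau_high : forall (j : 'I_m) l, (j < l)%N -> theta <= tau l - value j).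
Context (HP : H <= (P - 1) * alloc_step (n := n) m eps - 1).

Notation K := (session_arms N m P_ge1).
Context (T : nat).
Notation A := (session_auction N m n_gt0 heps P_ge1 htau T).
Context (fb : 'I_n -> feedback) (S : 'I_n -> strategy D K).
Context (g : R) (g_ge0 : 0 <= g).
Context (hg : forall i t (b b' : K),
  Pr A fb S (fun w => lags A g i t b b' w && (pulls_at w t i == b)) <= g).

Implicit Types (w : @outcome R D K n T) (t : 'I_T) (i : 'I_n) (j : 'I_m).

Notation sess := (session N T).
Notation E := (expect A fb S).
Notation subopt j := (suboptimal (@value R D) j).

Let eta := theta * alloc_step (n := n) m eps.
Let L : R := T%:R / N%:R + 1.
Let G : R := g * T%:R.
(** Chosen such that [H * X] covers [L + G] and [eta * X] covers [G], as [subopt_lags] requires. *)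
Let X : R := (L + G) / H + G / eta.

(** The type [j] need not be the value of buyer [i] in [w]: scores are tracked for all types at
    once. *)
Definition rho w i j t c : R := payoff_at m eps tau (statuses t (pulls_at w t)) i c (value j).

Let pulled w t i : 'I_(N * m).+1 := pulls_at w t i.

Definition early t : bool := elapsed N t <= X.

Lemma value_eq0 j : value j = 0 -> j = 0%N :> nat.
Proof.
move=> vj; apply/eqP; rewrite -leqn0 leqNgt; apply/negP => j0.
have /value_incr : (Ordinal (ltn_trans j0 (ltn_ord j)) < j)%N by [].
by rewrite vj ltNge; case/andP: (value_bounds (Ordinal (ltn_trans j0 (ltn_ord j)))) => ->.
Qed.

Lemma value_ge0 j : 0 <= value j.
Proof. by case/andP: (value_bounds j). Qed.

Lemma eta_gt0 : 0 < eta.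
Proof. by rewrite mulr_gt0// (alloc_step_gt0 _ heps (Ordinal n_gt0)). Qed.

Lemma rho0 w i j t : rho w i j t 0 = 0.
Proof. by rewrite /rho payoff_atE// big_nil. Qed.

Lemma rho_subopt w i j t c : subopt j c -> eta <= rho w i j t j.+1 - rho w i j t c.
Proof. exact: payoff_at_suboptimal. Qed.

Lemma rho_opt w i j t c : ~~ subopt j c -> rho w i j t c = rho w i j t j.+1.
Proof. by apply: payoff_at_optimal => //; exact: value_eq0. Qed.

Lemma rho_le1 w i j t c : (c <= m.+1)%N -> rho w i j t c <= 1.
Proof. by move=> cm; apply: payoff_at_le1 (value_bounds j). Qed.

Lemma rho_ge w i j t c : (c <= m.+1)%N -> - P <= rho w i j t c.
Proof. by move=> cm; apply: payoff_at_ge (value_ge0 j). Qed.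

Lemma rho_old w i j t : rho w i j t m.+1 <= - H.
Proof.
apply: le_trans (payoff_at_old heps htau _ _ tauP P_ge1 (value_bounds j)) _.
by move: HP; lra.
Qed.

Lemma card_sessL k : #|[pred t : 'I_T | sess t == k]|%:R <= L.
Proof. exact: card_session. Qed.

Lemma G_ge0 : 0 <= G. Proof. exact: mulr_ge0. Qed.

Lemma scoreE w i j t (b : K) :
  score (rho w i j) t b = sigma A w i b t (value j).
Proof. by apply: eq_bigr => u _; rewrite session_payoffE. Qed.

Definition anomalous w t i : bool :=
  [exists b : K, exists b' : K, lags A g i t b b' w && (pulls_at w t i == b)].

(** Union bound over the pairs of arms. *)
Lemma expect_anomalous t i : E (fun w => (anomalous w t i)%:R) <= (#|K| * #|K|)%:R * g.
Proof.
apply: (@le_trans _ _ (\sum_(b : K) \sum_(b' : K)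
    Pr A fb S (fun w => lags A g i t b b' w && (pulls_at w t i == b)))); last first.
  rewrite natrM -mulrA mulr_natl -sumr_const; apply: ler_sum => b _.
  by rewrite mulr_natl -sumr_const; apply: ler_sum => b' _.
under eq_bigr do under eq_bigr do rewrite -expect_Pr.
under eq_bigr do rewrite -expect_sum.
rewrite -expect_sum; apply: expect_le => w.
have [/existsP[b /existsP[b' bb']]|_] := boolP (anomalous w t i); last first.
  by apply: sumr_ge0 => b _; exact: sumr_ge0.
rewrite (bigD1 b)//= (bigD1 b')//= bb' -addrA lerDl.
by rewrite addr_ge0 ?sumr_ge0// => *; rewrite sumr_ge0.
Qed.

Lemma pulled_near_best w t i : ~~ anomalous w t i ->
  near_best (rho w i (value_at w t i)) G t (pulled w t i).
Proof.
move=> /existsPn/(_ (pulls_at w t i)) an; apply/forallP => b'.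
have /existsPn/(_ b') := an; rewrite eqxx andbT /lags -leNgt.
by rewrite -!scoreE.
Qed.

Definition gain w i j t : R :=
  top_score N m (rho w i j) t.+1 - top_score N m (rho w i j) t.

(** A decided round without anomaly pays at most the gain. In the others the payoff is at most 1 and
    the gain at least [- P], so an error of [P + 1] suffices. Splitting by the indicator of the
    value prepares the use of independence. *)
Lemma utility_le w t i : rho w i (value_at w t i) t (status N m (sess t) (pulled w t i)) <=
  \sum_j (value_at w t i == j)%:R * gain w i j t +
  (P + 1) * ((anomalous w t i)%:R + \sum_j (undecided N m (rho w i j) G t)%:R).
Proof.
rewrite (bigD1 (value_at w t i))//= eqxx mul1r big1 ?addr0; last first.
  by move=> j; rewrite eq_sym => /negPf ->; rewrite mul0r.
have P1 : 0 <= P + 1 by move: P_ge1; lra.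
have gain_geP : - P <= gain w i (value_at w t i) t.
  by apply: gain_ge => t' c; exact: rho_ge.
have triv : rho w i (value_at w t i) t (status N m (sess t) (pulled w t i)) <= 1.
  by rewrite rho_le1// status_le.
have trivial_bound x : 1 <= x ->
    rho w i (value_at w t i) t (status N m (sess t) (pulled w t i)) <=
    gain w i (value_at w t i) t + (P + 1) * x.
  by move=> x1; apply: le_trans triv _; nra.
have [an|/pulled_near_best nb] := boolP (anomalous w t i).
  by apply: trivial_bound; rewrite lerDl sumr_ge0.
have [und|dec] := boolP (undecided N m (rho w i (value_at w t i)) G t).
  apply: trivial_bound; rewrite add0r (bigD1 (value_at w t i))//= und lerDl.
  exact: sumr_ge0.
apply: (@le_trans _ _ (gain w i (value_at w t i) t)).
  exact: rho_le_gain G_ge0 _ _ nb dec.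
by rewrite lerDl mulr_ge0// addr_ge0// sumr_ge0.
Qed.

(** After the early rounds, a buyer who pulls no lagging arm has an optimal status, so
    [welfare_optimal] applies. An early or anomalous round is charged 1, which exceeds the whole
    target. *)
Lemma welfare_ge w t :
  (1 - eps) * \big[Num.max/0]_i value (value_at w t i)
    - (\sum_i (anomalous w t i)%:R + (early t)%:R)
  <= \sum_i value (value_at w t i) * alloc A t (pulls_at w t) i.
Proof.
have /andP[e0 e1] := heps.
have max01 : 0 <= \big[Num.max/0]_i value (value_at w t i) <= 1.
  rewrite bigmax_ge_id/=; apply: bigmax_le => // i _.
  by case/andP: (value_bounds (value_at w t i)).
have alloc0 i : 0 <= alloc A t (pulls_at w t) i by case/andP: (alloc_bounds A t (pulls_at w t) i).
have welf0 : 0 <= \sum_i value (value_at w t i) * alloc A t (pulls_at w t) i.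
  by apply: sumr_ge0 => i _; rewrite mulr_ge0// value_ge0.
have triv x : 1 <= x -> (1 - eps) * \big[Num.max/0]_i value (value_at w t i) - x <=
    \sum_i value (value_at w t i) * alloc A t (pulls_at w t) i.
  by move=> x1; apply: le_trans welf0; move: max01 => /andP[]; nra.
rewrite /early; have [le_X|gt_X] := leP (elapsed N t) X.
  by apply: triv; rewrite lerDr sumr_ge0.
have [/existsP[i an]|/existsPn ok] := boolP [exists i, anomalous w t i].
  by apply: triv; rewrite addr0 (bigD1 i)//= an lerDl sumr_ge0.
rewrite addr0 big1 ?subr0; last by move=> i _; rewrite (negPf (ok i)).
apply: (@welfare_optimal _ _ m eps heps (@value R D)) => //.
- exact: value_ge0.
- exact: value_incr.
- by move=> i; exact: statuses_le.
move=> i; apply/negP => so.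
have lag_old : L + G <= H * X.
  rewrite mulrDr mulrC divfK ?gt_eqF// lerDl mulr_ge0 ?(ltW H_gt0)//.
  by rewrite divr_ge0 ?G_ge0 ?(ltW eta_gt0).
have lag_new : G <= eta * X.
  rewrite mulrDr [eta * (G / _)]mulrC divfK ?gt_eqF ?eta_gt0// lerDr.
  rewrite mulr_ge0 ?(ltW eta_gt0)// divr_ge0 ?(ltW H_gt0)//.
  by rewrite !addr_ge0 ?divr_ge0 ?G_ge0.
have := subopt_lags N_gt0 (ltn_ord _) eta_gt0 H_gt0 (rho0 _ _ _) (@rho_subopt w i _)
  (@rho_opt w i _) (@rho_le1 w i _) (rho_old _ _ _) card_sessL lag_old lag_new gt_X so.
have /forallP/(_ (best N m (value_at w t i) (sess t))) := pulled_near_best (ok i).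
by rewrite leNgt => /negP.
Qed.

Lemma eq_top_score w w' i j s :
  (forall (u : 'I_T) c, (u < s)%N -> rho w i j u c = rho w' i j u c) ->
  top_score N m (rho w i j) s = top_score N m (rho w' i j) s.
Proof.
move=> ww'; suff sE : @score R T N m (rho w i j) s = score (rho w' i j) s.
  by rewrite /top_score sE.
by apply/funext => b; apply: eq_bigr => u us; rewrite ww'.
Qed.

Lemma eq_rho w w' i j t c : (forall i', i' != i -> w t i' = w' t i') ->
  rho w i j t c = rho w' i j t c.
Proof.
move=> ww'; apply: payoff_at_others => i' i'i.
by rewrite /statuses /pulls_at !ffunE ww'.
Qed.

(** Scores are hypothetical payoffs against the pulls of the others, so neither the values nor the
    own pulls of buyer [i] enter. *)
Lemma eq_gain w w' i j t :
  (forall (u : 'I_T) i', (u <= t)%N -> i' != i -> w u i' = w' u i') ->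
  gain w i j t = gain w' i j t.
Proof.
move=> ww'; rewrite /gain (@eq_top_score w w' i j t.+1); last first.
  by move=> u c ut; apply: eq_rho => i' i'i; exact: ww'.
rewrite (@eq_top_score w w' i j t)// => u c ut.
by apply: eq_rho => i' i'i; apply: ww' => //; exact: ltnW.
Qed.

Lemma expect_gain t i j : E (fun w => (value_at w t i == j)%:R * gain w i j t) =
  prob j * E (fun w => gain w i j t).
Proof.
apply: expect_indep => [w w' ww'|w y y' yy'].
  by apply: eq_gain => u i' ut _; rewrite ww'.
apply: eq_gain => u i' ut i'i.
by have [->|ne] := eqVneq u t; [rewrite !updateE yy'|rewrite !update_neq].
Qed.

(** Telescoping from score 0 to the final maximal score. *)
Lemma sum_gain_le w i j : \sum_t gain w i j t <= L.
Proof.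
rewrite -(big_mkord xpredT (fun s =>
  top_score N m (rho w i j) s.+1 - top_score N m (rho w i j) s)).
rewrite telescope_sumr// top_score0 subr0.
exact: (top_score_le N_gt0 H_gt0 (rho0 _ _ _) (@rho_le1 w i j) (rho_old _ _ _) card_sessL).
Qed.

Lemma sum_undecided_le w i j : \sum_t (undecided N m (rho w i j) G t)%:R <=
  N%:R * (N * m).+1%:R * (2 * G + eta) / eta.
Proof.
rewrite ler_pdivlMr ?eta_gt0// mulrC.
apply: le_trans (card_undecided N_gt0 (ltn_ord j) eta_gt0 (@rho_subopt w i j)
  (@rho_opt w i j) G_ge0).
rewrite -sum1_card natr_sum [X in _ <= _ * X]big_mkcond/=.
rewrite ler_pM2l ?eta_gt0//; apply: ler_sum => t _.
have -> : (t \in undecided N m (rho w i j) G) = undecided N m (rho w i j) G t by [].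
by case: (undecided _ _ _ _ _); rewrite ?lexx.
Qed.

(** In each session the elapsed rounds count up by 1, so at most [X + 1] rounds fall in the window
    from 0 to [X]. *)
Lemma sum_early_le : \sum_(t < T) (early t)%:R <= N%:R * (X + 1).
Proof.
have X0 : 0 <= X.
  rewrite addr_ge0// divr_ge0 ?(ltW eta_gt0) ?(ltW H_gt0) ?G_ge0//.
  by rewrite !addr_ge0 ?divr_ge0 ?G_ge0.
rewrite mulr_natl -[X in _ <= _ *+ X]card_ord -sumr_const.
apply: (@le_trans _ _ (\sum_(k < N) \sum_(t < T) ((sess t == k) && early t)%:R : R)).
  rewrite exchange_big/=; apply: ler_sum => t _.
  by rewrite (bigD1 (Ordinal (session_lt t N_gt0)))//= eqxx/= lerDl sumr_ge0.
apply: ler_sum => k _.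
have := @card_window R T (fun t => sess t == k) (fun=> 1) 0 1 0 X ler01 X0 (fun _ _ => lexx _).
rewrite subr0 mul1r; apply: le_trans.
rewrite -sum1_card natr_sum [X in _ <= X]big_mkcond/=; apply: ler_sum => t _.
rewrite inE/=; have [tk/=|//] := eqVneq (sess t) (k : nat).
suff -> : \sum_(u : 'I_T | (u < t)%N && (sess u == k)) 1 = elapsed N t :> R.
  rewrite add0r /early; have -> : 0 <= elapsed N t :> R by exact: ler0n.
  by rewrite /=; case: (_ <= X); rewrite ?lexx.
rewrite /elapsed -sum1_card natr_sum; apply: eq_bigl => u.
by rewrite inE tk.
Qed.

(** Revenue is welfare minus utilities; the subtracted terms are, in order, the anomalous rounds,
    the early rounds and the utilities of the [n] buyers. *)
Lemma revenue_ge :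
  T%:R * ((1 - eps) * Val n D)
    - T%:R * (n%:R * ((#|K| * #|K|)%:R * g)) - N%:R * (X + 1)
    - n%:R * (L + (P + 1) * (T%:R * ((#|K| * #|K|)%:R * g)
      + m%:R * (N%:R * (N * m).+1%:R * (2 * G + eta) / eta)))
  <= expected_revenue A fb S.
Proof.
set a := _%:R * g; set B := _ / eta.
have EV t : E (fun w => \big[Num.max/0]_i value (value_at w t i)) = Val n D.
  by rewrite (expect_values _ _ _ t (fun f => \big[Num.max/0]_i value (f i))).
have welf : T%:R * ((1 - eps) * Val n D) - T%:R * (n%:R * a) - N%:R * (X + 1) <=
    E (fun w => \sum_t \sum_i value (value_at w t i) * alloc A t (pulls_at w t) i).
  rewrite expect_sum.
  apply: (@le_trans _ _ (\sum_t ((1 - eps) * Val n D - (n%:R * a + (early t)%:R)))).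
    have -> : \sum_t ((1 - eps) * Val n D - (n%:R * a + (early t)%:R)) =
        T%:R * ((1 - eps) * Val n D) - (T%:R * (n%:R * a) + \sum_(t < T) (early t)%:R).
      by rewrite sumrB big_split/= !sumr_const card_ord !mulr_natl.
    rewrite opprD addrA lerD2l lerN2.
    exact: sum_early_le.
  apply: ler_sum => t _; apply: le_trans (expect_le _ _ _ (fun w => welfare_ge w t)).
  rewrite expectB expectZ EV expectD expect_cst expect_sum lerB// lerD2r.
  rewrite mulr_natl -[X in _ <= _ *+ X]card_ord -sumr_const.
  by apply: ler_sum => i _; exact: expect_anomalous.
have util : E (fun w => \sum_t \sum_i
      rho w i (value_at w t i) t (status N m (sess t) (pulled w t i))) <=
    n%:R * (L + (P + 1) * (T%:R * a + m%:R * B)).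
  have P1 : 0 <= P + 1 by move: P_ge1; lra.
  rewrite expect_sum; under eq_bigr do rewrite expect_sum.
  rewrite exchange_big/= mulr_natl -[X in _ <= _ *+ X]card_ord -sumr_const.
  apply: ler_sum => i _.
  apply: (@le_trans _ _ (\sum_t ((\sum_j prob j * E (fun w => gain w i j t)) +
      (P + 1) * (a + \sum_j E (fun w => (undecided N m (rho w i j) G t)%:R))))).
    apply: ler_sum => t _; apply: le_trans (expect_le _ _ _ (fun w => utility_le w t i)) _.
    rewrite expectD expectZ expectD !expect_sum lerD ?ler_wpM2l ?lerD2r ?expect_anomalous//.
    by apply: ler_sum => j _; rewrite expect_gain.
  rewrite big_split/= -mulr_sumr big_split/= sumr_const card_ord -[a *+ T]mulr_natl.
  apply: lerD; last rewrite ler_wpM2l// lerD2l.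
    (* The bound [L] on the total gain holds for each type, so it survives weighting the types by
       probabilities adding up to 1. *)
    rewrite exchange_big/= -[X in _ <= X]mul1r -(prob_sum1 D) mulr_suml.
    apply: ler_sum => j _; rewrite -mulr_sumr ler_wpM2l ?(ltW (prob_gt0 j))//.
    rewrite -expect_sum -[X in _ <= X](expect_cst A fb S).
    by apply: expect_le => w; exact: sum_gain_le.
  rewrite exchange_big/= mulr_natl -[X in _ <= _ *+ X]card_ord -sumr_const.
  apply: ler_sum => j _; rewrite -expect_sum -[X in _ <= X](expect_cst A fb S).
  by apply: expect_le => w; exact: sum_undecided_le.
apply: (le_trans (lerB welf util)); rewrite -expectB.
apply: expect_le => w; rewrite -sumrB; apply: ler_sum => t _.
rewrite -sumrB; apply: ler_sum => i _.
have -> : rho w i (value_at w t i) t (status N m (sess t) (pulled w t i)) =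
    payoff A t (pulls_at w t) i (pulls_at w t i) (value (value_at w t i)).
  by rewrite session_payoffE.
have -> : payoff A t (pulls_at w t) i (pulls_at w t i) (value (value_at w t i)) =
    value (value_at w t i) * alloc A t (pulls_at w t) i - price A t (pulls_at w t) i.
  (* Deviating to one's own pull changes nothing. *)
  rewrite /payoff; congr (_ * alloc A t _ i - price A t _ i);
  by apply/ffunP => i'; rewrite ffunE; case: eqP => // ->.
by rewrite opprB addrCA subrr addr0.
Qed.

End Revenue.

(** * Choice of the parameters *)

Lemma exists_pos_lower_bound {R : realType} (I : finType) (f : I -> R) :
  (forall i, 0 < f i) -> exists2 x, 0 < x & forall i, x <= f i.
Proof.
move=> f0; exists (\big[Num.min/1]_i f i); last by move=> i; exact: bigmin_le.
by apply: lt_bigmin => // i _; exact: f0.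
Qed.

Section Thresholds.
Context {R : realType} (D : value_dist R) (P : R) (P_gt1 : 1 < P).
Notation m := (supp_size D).

Definition value_nth (l : nat) : R := oapp (@value R D) 0 (insub l).

(** Midpoints separate neighbouring types strictly; from [m] on, the threshold [P] makes the top
    status a loss for every type. *)
Definition threshold (l : nat) : R :=
  if l == 0%N then 0 else
  if (l < m)%N then (value_nth l.-1 + value_nth l) / 2 else P.

Lemma value_nthE l (lm : (l < m)%N) : value_nth l = value (Ordinal lm).
Proof. by rewrite /value_nth insubT. Qed.

Lemma value_nth_bounds l : 0 <= value_nth l <= 1.
Proof. by rewrite /value_nth; case: insub => [j|] /=; rewrite ?value_bounds// lexx ler01. Qed.

Lemma threshold_bounds l : 0 <= threshold l <= P.
Proof.
rewrite /threshold; have P1 := P_gt1.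
have /andP[a0 a1] := value_nth_bounds l; have /andP[b0 b1] := value_nth_bounds l.-1.
by case: ifP => _; [|case: ifP => _]; apply/andP; split; lra.
Qed.

Lemma value_mono (j k : 'I_m) : (j <= k)%N -> value j <= value k.
Proof. by rewrite leq_eqVlt => /predU1P[/val_inj ->//|/value_incr/ltW]. Qed.

Lemma threshold_lt (j : 'I_m) l : (l <= j)%N ->
  ~~ ((l == 0%N) && (value j == 0)) -> threshold l < value j.
Proof.
move=> lj; rewrite /threshold; case: eqP => [_/=|/eqP l0 _].
  by rewrite lt_neqAle eq_sym => ->; case/andP: (value_bounds j).
have lm := leq_ltn_trans lj (ltn_ord j); rewrite lm.
have l1m : (l.-1 < m)%N by exact: leq_ltn_trans (leq_pred l) lm.
rewrite (value_nthE lm) (value_nthE l1m).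
have : value (Ordinal l1m) < value (Ordinal lm) by apply: value_incr; rewrite /= ltn_predL lt0n.
have : value (Ordinal lm) <= value j by exact: value_mono.
lra.
Qed.

Lemma threshold_gt (j : 'I_m) l : (j < l)%N -> value j < threshold l.
Proof.
move=> jl; rewrite /threshold; have l0 : (0 < l)%N by exact: leq_ltn_trans jl.
rewrite gtn_eqF//; case: ifP => [lm|_]; last first.
  by apply: le_lt_trans P_gt1; case/andP: (value_bounds j).
have l1m : (l.-1 < m)%N by exact: leq_ltn_trans (leq_pred l) lm.
rewrite (value_nthE lm) (value_nthE l1m).
have : value (Ordinal l1m) < value (Ordinal lm) by apply: value_incr; rewrite /= ltn_predL.
have : value j <= value (Ordinal l1m) by apply: value_mono; rewrite /= -ltnS prednK.
lra.
Qed.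

(** Finitely many strict inequalities have a common margin; thresholds of index above [m] equal the
    one at [m]. *)
Lemma threshold_gap : exists2 theta, 0 < theta &
  (forall (j : 'I_m) l, (l <= j)%N -> ~~ ((l == 0%N) && (value j == 0)) ->
     theta <= value j - threshold l) /\
  (forall (j : 'I_m) l, (j < l)%N -> theta <= threshold l - value j).
Proof.
(* The pair of threshold 0 and value 0 has no margin and gets the positive dummy 1. *)
pose f (p : 'I_m * 'I_m.+1) : R :=
  if (p.2 == 0%N :> nat) && (value p.1 == 0) then 1 else `|value p.1 - threshold p.2|.
have [|theta theta0 le_f] := @exists_pos_lower_bound R _ f.
  move=> [j l]; rewrite /f/=; case: ifPn => // jl.
  rewrite normr_gt0 subr_eq0; have [lj|jl'] := leqP l j.
    by rewrite gt_eqF// threshold_lt.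
  by rewrite lt_eqF// threshold_gt.
exists theta => //; split=> [j l lj jl|j l jl].
  have lm : (l < m.+1)%N by rewrite ltnS (leq_trans lj)// ltnW.
  have := le_f (j, Ordinal lm); rewrite /f/= (negPf jl) ger0_norm//.
  by rewrite subr_ge0 ltW// threshold_lt.
have jm : (j < minn l m)%N by rewrite leq_min jl ltn_ord.
have lm : (minn l m < m.+1)%N by rewrite ltnS geq_minr.
have -> : threshold l = threshold (minn l m).
  case: (leqP l m) => // ml.
  have m0 : (0 < m)%N by exact: leq_ltn_trans (ltn_ord j).
  by rewrite /threshold ltnn ltnNge (ltnW ml)/= !gtn_eqF// (ltn_trans m0).
have := le_f (j, Ordinal lm); rewrite /f/= gtn_eqF ?(leq_ltn_trans _ jm)//=.
by rewrite distrC ger0_norm// subr_ge0 ltW// threshold_gt.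
Qed.

Lemma threshold0 : threshold 0 = 0. Proof. by []. Qed.

Lemma threshold_last : threshold m = P.
Proof.
rewrite /threshold ltnn; case: eqP => // m0.
have := prob_sum1 D; rewrite big1 => [/eqP|j _]; first by rewrite eq_sym oner_eq0.
by have := ltn_ord j; rewrite {2}m0.
Qed.

End Thresholds.

(** * Elementary bounds and a common rate for all buyers *)

Lemma Val_ge0 {R : realType} n (D : value_dist R) : 0 <= Val n D.
Proof.
apply: sumr_ge0 => f _; rewrite mulr_ge0 ?bigmax_ge_id//.
by apply: prodr_ge0 => i _; rewrite ltW// prob_gt0.
Qed.

Lemma expected_revenue_ge0 {R : realType} (D : value_dist R) (K : arm_set R) n T
    (A : auction K n T) fb (S : 'I_n -> strategy D K) : 0 <= expected_revenue A fb S.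
Proof.
apply: sumr_ge0 => w _; rewrite mulr_ge0 ?outcome_prob_ge0// sumr_ge0// => t _.
by rewrite sumr_ge0// => i _; case/andP: (price_bounds A t (pulls_at w t) i).
Qed.

Lemma Pr_mono {R : realType} (D : value_dist R) (K : arm_set R) n T
    (A : auction K n T) fb (S : 'I_n -> strategy D K) (B C : pred outcome) :
  (forall w, B w -> C w) -> Pr A fb S B <= Pr A fb S C.
Proof.
move=> BC; rewrite -!expect_Pr; apply: expect_le => w.
by have [/BC ->|_] := boolP (B w).
Qed.

Lemma Pr_bounds {R : realType} (D : value_dist R) (K : arm_set R) n T
    (A : auction K n T) fb (S : 'I_n -> strategy D K) (B : pred outcome) :
  0 <= Pr A fb S B <= 1.
Proof.
rewrite sumr_ge0 ?(fun _ _ => outcome_prob_ge0 _ _ _ _)//=; last first.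
  by move=> *; exact: outcome_prob_ge0.
apply: le_trans (Pr_mono A fb S (C := predT) (fun _ _ => isT)) _.
by rewrite -expect_Pr expect1.
Qed.

Local Open Scope classical_set_scope.

(** The sum of the absolute values dominates each buyer's rate, and a larger rate only shrinks the
    lag event and weakens the bound. *)
Lemma mean_based_pull_le {R : realType} (D : value_dist R) (K : arm_set R) n
    (A : forall T, auction K n T) fb (S : nat -> 'I_n -> strategy D K) :
  (forall i, mean_based A fb S i) ->
  exists g : nat -> R, [/\ g @ \oo --> (0 : R), forall T, 0 <= g T &
    forall T i (t : 'I_T) b b',
      Pr (A T) fb (S T) (fun w => lags (A T) (g T) i t b b' w && (pulls_at w t i == b))
        <= g T].
Proof.
move=> mb.
have /choice[gam gamP] : forall i, exists gam : nat -> R, gam @ \oo --> (0 : R) /\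
    forall T, gamma_mean_based (A T) fb (S T) (gam T) i.
  by move=> i; have [gam] := mb i; exists gam.
pose g T := \sum_i `|gam i T|.
have le_g i T : `|gam i T| <= g T.
  by rewrite /g (bigD1 i)//= lerDl sumr_ge0.
exists g; split.
- rewrite (_ : 0 = \sum_(i < n) `|0 : R|); last by rewrite big1// => i _; rewrite normr0.
  apply: cvg_big => [|i _]; [exact: add_continuous|apply: cvg_norm]; exact: (gamP i).1.
- by move=> T; exact: sumr_ge0.
move=> T i t b b'.
apply: (@le_trans _ _ (gam i T * Pr (A T) fb (S T) (lags (A T) (gam i T) i t b b'))).
  apply: le_trans ((gamP i).2 T t b b'); apply: Pr_mono => w /andP[lg ->]; rewrite andbT.
  apply: lt_le_trans lg _; rewrite lerD2l lerN2 ler_wpM2r//.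
  exact: le_trans (ler_norm _) (le_g i T).
have /andP[p0 p1] := Pr_bounds (A T) fb (S T) (lags (A T) (gam i T) i t b b').
apply: le_trans (le_g i T); apply: le_trans (ler_norm _) _.
by rewrite normrM ler_piMr// ger0_norm.
Qed.

Lemma littleo_linear {R : realType} (g : nat -> R) (c1 c2 : R) :
  g @ \oo --> (0 : R) ->
  (fun T : nat => T%:R * (g T * c1) + c2) =o_\oo (fun T : nat => T%:R : R).
Proof.
move=> g0; apply/eqoP => _/posnumP[e].
have gc0 : g T * c1 @[T --> \oo] --> (0 : R) by rewrite -(mul0r c1); apply: cvgMr_tmp.
have e2 : 0 < e%:num / 2 by [].
near=> T.
have gT : `|g T * c1| <= e%:num / 2.
  by near: T; apply: cvgr0_norm_le gc0 _ e2.
have cT : `|c2| <= e%:num / 2 * T%:R.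
  rewrite -ler_pdivrMl// mulrC.
  by near: T; exact: nbhs_infty_ger.
apply: le_trans (ler_normD _ _) _; rewrite normrM.
have -> : e%:num * `|T%:R : R| = `|T%:R : R| * (e%:num / 2) + e%:num / 2 * T%:R.
  by rewrite ger0_norm//; field.
by rewrite lerD// ler_wpM2l.
Unshelve. all: by end_near.
Qed.

Theorem theorem4 (R : realType) (D : value_dist R) (n : nat) (hn : (1 <= n)%N)
    (delta : R) (hdelta : 0 < delta < 1) :
  exists (K : arm_set R) (A : forall T : nat, auction K n T),
  forall (fb : 'I_n -> feedback) (S : nat -> 'I_n -> strategy D K),
    (forall i : 'I_n, mean_based A fb S i) ->
    exists2 err : nat -> R,
      err =o_\oo (fun T : nat => T%:R : R) &
      forall T : nat,
        T%:R * (1 - delta) * Val n D - err T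
          <= expected_revenue (A T) fb (S T).
Proof.
have /andP[d0 d1] := hdelta.
(* Half of [delta] pays for the inefficiency of the mechanism, the other half for the loss
   [H^-1 + n / N] per round, relative to [V]. *)
pose m := supp_size D; pose V := Val n D; pose eps := delta / 2.
have heps : 0 < eps < 1 by rewrite /eps; apply/andP; split; lra.
pose step := alloc_step (n := n) m eps.
have step0 : 0 < step := alloc_step_gt0 m heps (Ordinal hn).
have [N [H [N0 H0 NH]]] : exists (N : nat) (H : R), [/\ (0 < N)%N, 0 < H &
    V != 0 -> H^-1 + n%:R / N%:R <= eps * V].
  (* For [V = 0] any choice will do, since revenue is nonnegative. *)
  have [->|V0] := eqVneq V 0; first by exists 1%N, 1.
  have {}V0 : 0 < V by rewrite lt_neqAle eq_sym V0 Val_ge0.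
  have eV : 0 < eps * V / 2 by rewrite !mulr_gt0//; case/andP: heps.
  (* Each of [H^-1] and [n / N] takes at most half of [eps * V]. *)
  pose N := (Num.bound (n%:R / (eps * V / 2))).+1; exists N, (eps * V / 2)^-1.
  split=> //; first by rewrite invr_gt0.
  move=> _; rewrite invrK; suff : n%:R / N%:R <= eps * V / 2 by lra.
  rewrite ler_pdivrMr ?ltr0n// mulrC -ler_pdivrMr//.
  apply: le_trans (ltW (archi_boundP _)) _; first by rewrite divr_ge0// ltW.
  by rewrite ler_nat.
(* The solution of [H = (P - 1) * step - 1], so that an arm of a former session pays at most
   [- H]. *)
pose P := 1 + (1 + H) / step.
have P1 : 1 < P by rewrite /P ltrDl divr_gt0// addr_gt0.
have [theta theta0 [tau_low tau_high]] := threshold_gap D P1.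
have htau := threshold_bounds D P1.
have HP : H <= (P - 1) * step - 1.
  by rewrite /P [1 + _ - 1]addrAC subrr add0r divfK ?gt_eqF//; lra.
exists (session_arms N m (ltW P1)).
exists (session_auction N m hn heps (ltW P1) htau) => fb S mb.
have [V0|V0] := eqVneq V 0.
  exists (fun=> 0) => [|T]; last by rewrite -/V V0 mulr0 subr0 expected_revenue_ge0.
  by apply/eqoP => e e0; near=> T; rewrite normr0 mulr_ge0// ltW.
have [g [g_cvg g_ge0 hg]] := mean_based_pull_le mb.
pose K2 : R := (#|session_arms N m (ltW P1)| * #|session_arms N m (ltW P1)|)%:R.
pose eta := theta * step.
have eta0 : 0 < eta by rewrite mulr_gt0.
pose c : R := N%:R * (N * m).+1%:R.
(* As [N], [H] and [P] do not depend on [T], the remaining error is [C1] times [g T * T] plus the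
   constant [C2]. *)
pose C1 := n%:R * K2 + N%:R / H + N%:R / eta
  + n%:R * ((P + 1) * (K2 + m%:R * (c * 2 / eta))).
pose C2 := N%:R / H + N%:R + n%:R * (1 + (P + 1) * (m%:R * c)).
exists (fun T => T%:R * (g T * C1) + C2); first exact: littleo_linear.
move=> T; have := revenue_ge N0 theta0 H0 (threshold0 D P)
  (threshold_last D P) tau_low tau_high HP (g_ge0 T) (hg T).
apply: le_trans.
have -> : T%:R * ((1 - eps) * Val n D) -
    T%:R * (n%:R * (K2 * g T)) -
    N%:R * ((T%:R / N%:R + 1 + g T * T%:R) / H + g T * T%:R / eta + 1) -
    n%:R * (T%:R / N%:R + 1 + (P + 1) * (T%:R * (K2 * g T)
      + m%:R * (c * (2 * (g T * T%:R) + eta) / eta))) =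
  T%:R * ((1 - eps) * V - (H^-1 + n%:R / N%:R)) - (T%:R * (g T * C1) + C2).
  rewrite /C1 /C2 /V; field.
  by rewrite !gt_eqF ?ltr0n.
rewrite lerD2r -mulrA ler_wpM2l//; have := NH V0.
by rewrite /eps -/V; lra.
Unshelve. all: by end_near.
Qed.
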